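(* Let $\sigma,\tau\in\mathcal{W}_0$ with associated weight matrices $\mathcal{M}_\sigma=\{\mathbf{S}^{(\ell)}:\ell>0\}$ and $\mathcal{M}_\tau=\{\mathbf{T}^{(\ell)}:\ell>0\}$. Then: (i) For all $\ell,\ell_1>0$: $\omega_{\mathbf{S}^{(\ell)}\cdot\mathbf{T}^{(\ell_1)}}=\omega_{\mathbf{S}^{(\ell)}}\check{\star}\,\omega_{\mathbf{T}^{(\ell_1)}}\sim\sigma\check{\star}\tau$; in particular $\omega_{\mathbf{S}^{(\ell)}\cdot\mathbf{T}^{(\ell)}}\sim\omega_{\mathbf{S}^{(j)}\cdot\mathbf{T}^{(j)}}$ for all $\ell,j>0$. (ii) For all $\ell>0$ and all $p,q\in\mathbb{N}$: $S^{(\ell)}_{p+q}T^{(\ell)}_{p+q}\le S^{(2\ell)}_pT^{(2\ell)}_p\,S^{(2\ell)}_qT^{(2\ell)}_q$. (iii) If at least one of $\sigma,\tau$ satisfies $(\omega_1)$, then $$\forall\,h\ge1\ \exists\,d\ge1\ \forall\,\ell>0\ \exists\,D\ge1\ \forall\,p\in\mathbb{N}:\quad h^pS^{(\ell)}_pT^{(\ell)}_p\le D\,S^{(d\ell)}_pT^{(d\ell)}_p.$$ (iv) If at least one of $\sigma,\tau$ satisfies $(\omega_1)$, then, as locally convex vector spaces, $$\forall\,\ell,j>0:\quad \mathfrak{F}_{[\mathcal{M}_\sigma\cdot\mathcal{M}_\tau]}=\mathfrak{F}_{[\omega_{\mathbf{S}^{(\ell)}\cdot\mathbf{T}^{(j)}}]}=\mathfrak{F}_{[\sigma\check{\star}\tau]}$$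 for every $\mathfrak{F}\in\{\mathcal{E},\mathcal{B},\mathcal{A},\mathcal{S},\Lambda,\mathcal{F}\}$, in both the Roumieu case $[\cdot]=\{\cdot\}$ and the Beurling case $[\cdot]=(\cdot)$. (v) Assume that at least one of $\sigma,\tau$ satisfies $(\omega_1)$. If $\tau$ satisfies in addition $(\omega_6)$, then $\mathcal{M}_\sigma\cdot\mathcal{M}_\tau\,[\approx]\,\mathcal{M}_\sigma\cdot\mathbf{T}^{(j)}$ for any $j>0$; if $\sigma$ satisfies in addition $(\omega_6)$, then $\mathcal{M}_\sigma\cdot\mathcal{M}_\tau\,[\approx]\,\mathbf{S}^{(\ell)}\cdot\mathcal{M}_\tau$ for any $\ell>0$ (for both meanings of $[\cdot]$). In the first case the spaces in (iv) also coincide (as locally convex vector spaces) with $\mathfrak{F}_{[\mathcal{M}_\sigma\cdot\mathbf{T}^{(j)}]}$, $j>0$ arbitrary, and in the second case with $\mathfrak{F}_{[\mathbf{S}^{(\ell)}\cdot\mathcal{M}_\tau]}$, $\ell>0$ arbitrary.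
   Context: $\mathbb{N}=\{0,1,2,\dots\}$. Weight functions. $\mathcal{W}_0$ is the set of all continuous, non-decreasing $\omega:[0,+\infty)\to[0,+\infty)$ with $\omega(t)=0$ for $t\in[0,1]$, $\lim_{t\to+\infty}\omega(t)=+\infty$, $\log t=o(\omega(t))$ as $t\to+\infty$, and $\varphi_\omega:t\mapsto\omega(e^t)$ convex on $\mathbb{R}$. Conditions: $(\omega_1)$: $\omega(2t)=O(\omega(t))$ as $t\to+\infty$; $(\omega_6)$: $\exists H\ge1\ \forall t\ge0:\ 2\omega(t)\le\omega(Ht)+H$. Write $\sigma\sim\tau$ if $\sigma(t)=O(\tau(t))$ and $\tau(t)=O(\sigma(t))$ as $t\to+\infty$. Associated weight matrix. For $\omega\in\mathcal{W}_0$: $\varphi^*_\omega(x):=\sup_{y\ge0}\{xy-\varphi_\omega(y)\}$, $x\ge0$, and $\mathcal{M}_\omega:=\{\mathbf{W}^{(\ell)}:\ell>0\}$ with $W^{(\ell)}_p:=\exp(\frac1\ell\varphi^*_\omega(\ell p))$, $p\in\mathbb{N}$. The matrices of $\sigma,\tau$ are denoted by $\{\mathbf{S}^{(\ell)}\}$, $\{\mathbf{T}^{(\ell)}\}$. Associated weight function. For a positive sequence $\mathbf{M}$ with $M_0=1$: $\omega_{\mathbf{M}}(t):=\sup_{p\in\mathbb{N}}\log(t^p/M_p)$, $t\ge0$ (with $0^0:=1$). Generalized lower Legendre conjugate: $\sigma\check{\star}\tau(t):=\inf_{s>0}\{\sigma(s)+\tau(t/s)\}$, $t\ge0$. Products.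 $\mathbf{M}\cdot\mathbf{N}:=(M_pN_p)_p$; $\mathcal{M}_\sigma\cdot\mathcal{M}_\tau:=\{\mathbf{S}^{(\ell)}\cdot\mathbf{T}^{(\ell)}:\ell>0\}$; $\mathcal{M}_\sigma\cdot\mathbf{N}:=\{\mathbf{S}^{(\ell)}\cdot\mathbf{N}:\ell>0\}$ and similarly $\mathbf{N}\cdot\mathcal{M}_\tau$. Relations. $\mathbf{M}\preceq\mathbf{N}$ means $\sup_{p\ge1}(M_p/N_p)^{1/p}<+\infty$. For $\mathcal{M}=\{\mathbf{M}^{(x)}\}$, $\mathcal{N}=\{\mathbf{N}^{(x)}\}$: $\mathcal{M}\{\preceq\}\mathcal{N}$ iff $\forall\alpha>0\,\exists\beta>0:\mathbf{M}^{(\alpha)}\preceq\mathbf{N}^{(\beta)}$; $\mathcal{M}(\preceq)\mathcal{N}$ iff $\forall\alpha>0\,\exists\beta>0:\mathbf{M}^{(\beta)}\preceq\mathbf{N}^{(\alpha)}$; $\mathcal{M}\{\approx\}\mathcal{N}$ (resp. $\mathcal{M}(\approx)\mathcal{N}$) iff $\{\preceq\}$ (resp. $(\preceq)$) holds in both directions. $[\cdot]$ denotes either $\{\cdot\}$ (Roumieu) or $(\cdot)$ (Beurling), the same choice throughout a formula. Weighted spaces. For a positive sequence $a=(a_p)_p$ consider the following (semi-)norms: $\mathcal{E}$: for $f\in C^\infty(U)$, $U\subseteq\mathbb{R}^d$ non-empty open, $K\subset U$ compact: $\sup_{x\in K,\beta\in\mathbb{N}^d}|\partial^\beta f(x)|/a_{|\beta|}$;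 $\mathcal{B}$: for $f\in C^\infty(U)$: $\sup_{x\in U,\beta\in\mathbb{N}^d}|\partial^\beta f(x)|/a_{|\beta|}$; $\mathcal{A}$: for $f$ holomorphic on an unbounded sector $S$ (of the Riemann surface of the logarithm): $\sup_{z\in S,p\in\mathbb{N}}|f^{(p)}(z)|/a_p$; $\mathcal{S}$: for $f\in C^\infty(\mathbb{R})$: $\sup_{x\in\mathbb{R},j,k\in\mathbb{N}}(1+|x|)^k|f^{(j)}(x)|/a_{j+k}$; $\Lambda$: for complex sequences $(c_p)_p$: $\sup_p|c_p|/a_p$; $\mathcal{F}$: for formal power series $\sum_pc_px^p$ with complex coefficients: $\sup_p|c_p|/a_p$. For a family $\mathcal{M}=\{\mathbf{M}^{(\ell)}:\ell>0\}$: $\mathfrak{F}_{(\mathcal{M})}$ consists of the elements for which these quantities are finite with $a=(h^pM^{(\ell)}_p)_p$ for all $\ell,h>0$ (and all $K$ if $\mathfrak{F}=\mathcal{E}$), with the topology generated by them; $\mathfrak{F}_{\{\mathcal{M}\}}$ requires finiteness for some $\ell,h>0$ (for $\mathcal{E}$: for every $K$ there exist $\ell,h>0$), with the inductive limit topology over $(\ell,h)$ (for $\mathcal{E}$: projective limit over $K$ of inductive limits). For a non-decreasing $\omega:[0,+\infty)\to[0,+\infty)$ with $\log t=o(\omega(t))$, $\mathfrak{F}_{(\omega)}$ and $\mathfrak{F}_{\{\omega\}}$ are defined in the same way with $a=\mathbf{W}^{(\ell)}$, $\ell>0$, and no factor $h^p$, where $W^{(\ell)}_p=\exp(\frac1\ell\varphi^*_\omega(\ell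 p))$ and, if $\omega$ is not zero on $[0,1]$, $\varphi^*_\omega(x):=\sup_{y\in\mathbb{R}}\{xy-\omega(e^y)\}$ (for $\omega\in\mathcal{W}_0$ both suprema agree). *)

(* Defs.v *)
From HB Require Import structures.
From mathcomp Require Import all_boot all_order all_algebra.
From mathcomp Require Import complex.
From mathcomp Require Import all_classical all_reals all_analysis.

Set Implicit Arguments.
Unset Strict Implicit.
Unset Printing Implicit Defensive.

Import Order.TTheory GRing.Theory Num.Theory.
Import numFieldNormedType.Exports.

Local Open Scope classical_set_scope.
Local Open Scope ring_scope.

(* A function on [0, +oo[ is represented by a function on R of which only the
   values on [0, +oo[ matter. *)

Section Weights.
Variable R : realType.
Implicit Types (w v : R -> R) (M N : nat -> R).

Canonical pinfty_filter_on : filter_on R :=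
  FilterType (pinfty_nbhs R) _.

Definition phi w : R -> R := fun y => w (expR y).

Record W0 w : Prop := IsW0 {
  W0_ge0 : forall t, 0 <= t -> 0 <= w t;
  W0_continuous : {within `[0, +oo[, continuous w};
  W0_nondecreasing : {in `[0, +oo[ &, {homo w : s t / s <= t}};
  W0_zero : {in `[0, 1], forall t, w t = 0};
  W0_cvgy : w t @[t --> +oo] --> +oo;
  W0_ln : (@ln R : R -> R^o) =o_ (pinfty_nbhs R) (w : R -> R^o);
  W0_convex : convex_function setT (phi w)
}.

Definition omega1 w :=
  ((fun t => w (2 * t)) : R -> R^o) =O_ (pinfty_nbhs R) (w : R -> R^o).

Definition omega6 w :=
  exists2 H : R, 1 <= H & forall t, 0 <= t -> 2 * w t <= w (H * t) + H.

Definition wequiv w v :=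
  (w : R -> R^o) =O_ (pinfty_nbhs R) (v : R -> R^o) /\
  (v : R -> R^o) =O_ (pinfty_nbhs R) (w : R -> R^o).

(* If w >= 0 vanishes on [0, 1], the negative y do not contribute to the
   supremum at any x >= 0. *)
Definition phi_star_dom w : set R :=
  if `[< {in `[0, 1], forall t, w t = 0} >] then [set y | 0 <= y] else setT.

(* The suprema in [phi_star] and [omega_of] are real-valued versions: they are
   finite for the weights considered here, where ln t = o(w(t)). *)
Definition phi_star w (x : R) : R :=
  sup [set x * y - phi w y | y in phi_star_dom w].

Definition wmatrix w (l : R) : nat -> R :=
  fun p => expR (l^-1 * phi_star w (l * p%:R)).

(* [lne] has value -oo at 0, so only p = 0 contributes at t = 0. *)
Definition omega_of M (t : R) : R :=
  fine (ereal_sup [set lne (t ^+ p / M p)%:E | p in [set: nat]]).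

Definition legendre w v (t : R) : R :=
  inf [set w s + v (t / s) | s in [set s | 0 < s]].

Definition seq_preceq M N : Prop :=
  (ereal_sup [set ((M p / N p) `^ (p%:R^-1))%:E | p in [set p | (1 <= p)%N]]
    < +oo)%E.

End Weights.

Variant kind := Roumieu | Beurling.

(* A family (M^(l))_{l > 0} is represented by a function on R of which only
   the values at l > 0 matter. *)

Section WeightMatrices.
Variable R : realType.
Implicit Types (M N : R -> nat -> R).

Definition mprod M N : R -> nat -> R := fun l => M l \* N l.

Definition mpreceq (k : kind) M N : Prop :=
  match k with
  | Roumieu => forall a, 0 < a -> exists2 b, 0 < b & seq_preceq (M a) (N b)
  | Beurling => forall a, 0 < a -> exists2 b, 0 < b & seq_preceq (M b) (N a)
  end.

Definition mapprox (k : kind) M N : Prop := mpreceq k M N /\ mpreceq k N M.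

Definition mat_weights M : set (nat -> R) :=
  [set a | exists l h, [/\ 0 < l, 0 < h & a = fun p => h ^+ p * M l p]].

Definition omega_weights (w : R -> R) : set (nat -> R) :=
  [set wmatrix w l | l in [set l | 0 < l]].

End WeightMatrices.

Section LocallyConvexSpaces.
Variables (R : realType) (V : lmodType R[i]).
Implicit Types (E : set V) (Q : set (V -> R)).

(* A topological vector space whose underlying vector space is the linear
   subspace [lcs_set] of V; [lcs_open] is the collection of its open sets. *)
Record lcspace := LCSpace { lcs_set : set V; lcs_open : set (set V) }.

Definition seminorm_on E (q : V -> R) : Prop :=
  (forall f g, E f -> E g -> q (f + g) <= q f + q g) /\
  (forall (c : R[i]) f, E f -> q (c *: f) = Normc.normc c * q f).

Definition seminorm_open E Q : set (set V) :=
  [set O | O `<=` E /\ forall f, O f ->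
     exists (s : seq (V -> R)) (e : R), [/\ {in s, forall q, Q q}, 0 < e &
       forall g, E g -> {in s, forall q : V -> R, q (g - f) < e} -> O g]].

Definition seminorm_space E Q : lcspace := LCSpace E (seminorm_open E Q).

Variables (I : Type) (N : I -> (nat -> R) -> V -> \bar R).
Variables (X : set V) (A : set (nat -> R)).

Definition step (i : I) (a : nat -> R) : set V :=
  [set f | X f /\ (N i a f < +oo)%E].

Definition projective_space : lcspace :=
  seminorm_space
    [set f | forall i a, A a -> step i a f]
    [set q | exists i a, A a /\ q = fine \o N i a].

(* The inductive limit over a in A of the seminormed spaces [step i a] carries
   the finest locally convex topology for which all inclusions are continuous:
   it is generated by all seminorms with continuous restrictions to the
   steps. *)
Definition inductive_set (i : I) : set V :=
  [set f | exists2 a, A a & step i a f].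

Definition inductive_seminorm (i : I) : set (V -> R) :=
  [set q | seminorm_on (inductive_set i) q /\
     forall a, A a -> exists C : R,
       forall f, step i a f -> q f <= C * fine (N i a f)].

Definition proj_inductive_space : lcspace :=
  seminorm_space
    [set f | forall i, inductive_set i f]
    [set q | exists i, inductive_seminorm i q].

End LocallyConvexSpaces.

(* [fc_index] is the set of compacts K in the class E, and a singleton for the
   other classes. *)
Record fclass (R : realType) := FClass {
  fc_vect : lmodType R[i];
  fc_elem : set fc_vect;
  fc_index : Type;
  fc_norm : fc_index -> (nat -> R) -> fc_vect -> \bar R
}.

Definition fspace (R : realType) (F : fclass R) (k : kind)
    (A : set (nat -> R)) : lcspace (fc_vect F) :=
  match k with
  | Roumieu => proj_inductive_space (@fc_norm R F) (@fc_elem R F) A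
  | Beurling => projective_space (@fc_norm R F) (@fc_elem R F) A
  end.

Section Classes.
Variable R : realType.
Implicit Types (a : nat -> R).
Local Notation C := (R[i]^o).
Local Notation normc := Normc.normc.
Local Notation re f := (fun x => complex.Re (f x)).
Local Notation im f := (fun x => complex.Im (f x)).

(* Functions on a set D are represented by their extension by 0. *)
Definition vanish_off (T : Type) (D : set T) (f : T -> C) : Prop :=
  forall x, ~ D x -> f x = 0.

Section Open.
Variable d : nat.
Implicit Types (U K : set 'rV[R]_d) (f : 'rV[R]_d -> C).

Definition partial (i : 'I_d) f : 'rV[R]_d -> C :=
  fun x => Complex ('D_(delta_mx 0 i) (re f) x) ('D_(delta_mx 0 i) (im f) x).

Definition mpartial (b : {ffun 'I_d -> nat}) f : 'rV[R]_d -> C :=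
  foldr (fun i g => iter (b i) (partial i) g) f (enum 'I_d).

Definition morder (b : {ffun 'I_d -> nat}) : nat := (\sum_i b i)%N.

Definition smooth_on U f : Prop :=
  forall (s : seq 'I_d) (x : 'rV[R]_d), U x ->
    let g := foldr partial f s in
    [/\ {for x, continuous (re g)}, {for x, continuous (im g)} &
        forall i, derivable (re g) x (delta_mx 0 i) /\
                  derivable (im g) x (delta_mx 0 i)].

Definition norm_on K a f : \bar R :=
  ereal_sup [set (normc (mpartial b f x) / a (morder b))%:E |
              x in K & b in [set: {ffun 'I_d -> nat}]].

Definition class_E U : fclass R :=
  @FClass R ('rV[R]_d -> C) [set f | smooth_on U f /\ vanish_off U f]
    {K : set 'rV[R]_d | compact K /\ K `<=` U} (fun k => norm_on (sval k)).

Definition class_B U : fclass R :=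
  @FClass R ('rV[R]_d -> C) [set f | smooth_on U f /\ vanish_off U f]
    unit (fun=> norm_on U).

End Open.

(* The Riemann surface of the logarithm consists of the points (r, t) with
   r > 0 and t real, lying over r exp(it); unbounded sectors are given by
   lower and upper bounds for the argument t. *)
Section Sector.
Implicit Types (S : set (R * R)) (f : R * R -> C).

Definition sector (t0 t1 : R) : set (R * R) :=
  [set z | 0 < z.1 /\ t0 < z.2 < t1].

Definition log_proj (z : R * R) : C := Complex (z.1 * cos z.2) (z.1 * sin z.2).

Definition diff_quot f (z : R * R) : R * R -> C :=
  fun y => (f y - f z) / (log_proj y - log_proj z).

Definition cderive f : R * R -> C := fun z => lim (diff_quot f z @ z^').

Definition holomorphic_on S f : Prop :=
  forall z, S z -> cvg (diff_quot f z @ z^').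

Definition class_A (t0 t1 : R) : fclass R :=
  @FClass R (R * R -> C)
    [set f | holomorphic_on (sector t0 t1) f /\ vanish_off (sector t0 t1) f]
    unit
    (fun _ a f => ereal_sup [set (normc (iter p cderive f z) / a p)%:E |
                              z in sector t0 t1 & p in [set: nat]]).

End Sector.

Section Line.
Implicit Types (f : R -> C).

Definition derivC f : R -> C :=
  fun x => Complex (derive1 (re f) x) (derive1 (im f) x).

Definition smooth_line f : Prop :=
  forall n x, derivable (re (iter n derivC f)) x 1 /\
              derivable (im (iter n derivC f)) x 1.

Definition class_S : fclass R :=
  @FClass R (R -> C) [set f | smooth_line f] unit
    (fun _ a f => ereal_sup
      [set ((1 + `|u.1|) ^+ u.2.2 * normc (iter u.2.1 derivC f u.1)
             / a (u.2.1 + u.2.2)%N)%:E | u in [set: R * (nat * nat)]]).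

End Line.

Definition class_Lambda : fclass R :=
  @FClass R (nat -> C) setT unit
    (fun _ a c => ereal_sup [set (normc (c p) / a p)%:E | p in [set: nat]]).

(* A formal power series is given by its coefficients. *)
Definition class_F : fclass R :=
  @FClass R (nat -> C) setT unit
    (fun _ a c => ereal_sup [set (normc (c p) / a p)%:E | p in [set: nat]]).

Variant weighted_class : fclass R -> Prop :=
| WC_E d (U : set 'rV[R]_d) of (0 < d)%N & open U & U !=set0 :
    weighted_class (class_E U)
| WC_B d (U : set 'rV[R]_d) of (0 < d)%N & open U & U !=set0 :
    weighted_class (class_B U)
| WC_A (t0 t1 : R) of t0 < t1 : weighted_class (class_A t0 t1)
| WC_S : weighted_class class_S
| WC_Lambda : weighted_class class_Lambda
| WC_F : weighted_class class_F.

End Classes.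

(* Main.v *)
(** Convexity of the conjugates makes the sequences [S^(l)], [T^(l)]
    log-convex, so that a maximizing index for [t^p / (S_p T_p)] simultaneously
    maximizes [s^p / S_p] and [(t/s)^p / T_p] for a suitable splitting
    [t = s (t/s)]; this is the formula for the lower Legendre conjugate. On the
    side of the weight functions the conjugate of [legendre sigma tau] is the sum
    of the conjugates, so its weight matrix is exactly the product matrix
    [S^(l) T^(l)], and equivalent weight functions have mutually cofinal weight
    matrices. All seminorms are suprema of quotients by the weight sequence,
    hence cofinality transfers to the spaces. In the Beurling case one also
    needs that the spaces are closed under subtraction. For holomorphic functions
    this requires the regularity of derivatives: as [f'] is bounded, the circle
    means of the difference quotient of [f] are independent of the radius, which
    represents [f'] by an integral of [f] and makes it differentiable. *)

Require Import Defs.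
From HB Require Import structures.
From mathcomp Require Import all_boot all_order all_algebra.
From mathcomp Require Import complex.
From mathcomp Require Import all_classical all_reals all_analysis.
From mathcomp Require Import ring lra zify.

Set Implicit Arguments.
Unset Strict Implicit.
Unset Printing Implicit Defensive.

Import Order.TTheory GRing.Theory Num.Theory.
Import numFieldNormedType.Exports.

Local Open Scope classical_set_scope.
Local Open Scope ring_scope.

(** * Weight functions, conjugates and weight matrices *)

Section Weights.
Variable R : realType.
Implicit Types (w v : R -> R) (a b : nat -> R) (x y t l c : R).

(** The comparison lemmas assume [zero01], [nneg_fun] and [superlog] instead of [W0], because these
    three properties can be verified for [legendre sigma tau] and for the associated weight
    functions as well. An associated weight function samples the conjugate only at the points l p,
    so the slope of a supporting line must be rounded to a multiple of l; the error l ln t is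
    absorbed by log t = o(w(t)), at the price of a factor 2. Families attached to a matrix carry
    factors h^p, those attached to a weight function do not; [omega1] exchanges h^p for a larger
    index. The difficulty with differences of holomorphic functions is that [cderive] is a [lim],
    hence linear only where the difference quotients converge, while membership in the class
    provides this only for the first derivative. A finite norm bounds all derivatives, and in the
    chart u -> e^u the circle means, which work for a derivative only known to be bounded, make each
    derivative differentiable in turn. *)

Definition zero01 w := forall t, 0 <= t <= 1 -> w t = 0.

Definition nneg_fun w := forall t, 0 <= t -> 0 <= w t.

Lemma W0_zero01 w : W0 w -> zero01 w.
Proof. by move=> /W0_zero w0 t t01; apply: w0; rewrite in_itv. Qed.

Lemma W0_nneg w : W0 w -> nneg_fun w.
Proof. by move=> ww t; apply: (W0_ge0 ww). Qed.

Lemma W0_homo w s t : W0 w -> 0 <= s -> s <= t -> w s <= w t.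
Proof.
move=> /W0_nondecreasing ww s0 st.
by apply: ww => //; rewrite in_itv/= andbT// (le_trans s0).
Qed.

(** The condition log t = o(w(t)) in the variable y = ln t. It bounds from above the set whose
    supremum is [phi_star]. *)
Definition superlog w := forall c, exists D, forall y, 0 <= y -> c * y <= phi w y + D.

Lemma W0_superlog w : W0 w -> superlog w.
Proof.
move=> ww c.
have c1 : 0 < `|c| + 1 by rewrite ltr_pwDr.
have /eqoP/(_ (`|c| + 1)^-1) := W0_ln ww.
rewrite invr_gt0 => /(_ c1) [T [Treal HT]].
exists (`|c| * `|T|) => y y0.
have w0 : 0 <= phi w y by apply: (W0_nneg ww); exact: expR_ge0.
have cy : c * y <= `|c| * y by rewrite ler_wpM2r // ler_norm.
have [yT|Ty] := leP y `|T|.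
  rewrite (le_trans cy)// (le_trans (ler_wpM2l _ yT))//.
  by rewrite lerDr.
have := HT (expR y).
have -> : T < expR y.
  rewrite (le_lt_trans (ler_norm T))// (lt_le_trans Ty)//.
  by rewrite (le_trans _ (expR_ge1Dx y))// lerDr.
move=> /(_ isT); rewrite expRK -/(phi w y) (ger0_norm y0) (ger0_norm w0) => H.
have : (`|c| + 1) * y <= phi w y.
  by rewrite mulrC -ler_pdivlMr// mulrC.
rewrite mulrDl mul1r => H2.
rewrite (le_trans cy)// ler_wpDr ?mulr_ge0//.
by rewrite (le_trans _ H2)// lerDl.
Qed.

Lemma phi0 w : zero01 w -> phi w 0 = 0.
Proof. by move=> w0; rewrite /phi expR0 w0// ler01 lexx. Qed.

Lemma phi_star_domE w : zero01 w -> phi_star_dom w = [set y | 0 <= y].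
Proof.
by move=> w0; rewrite /phi_star_dom; case: asboolP.
Qed.

Lemma phi_star_ub w x y : zero01 w -> superlog w -> 0 <= y ->
  x * y - phi w y <= phi_star w x.
Proof.
move=> w0 sw y0; apply: ub_le_sup; last first.
  by exists y => //; rewrite phi_star_domE.
have [D HD] := sw x; exists D => _ [z + <-].
rewrite phi_star_domE//= => z0; rewrite lerBlDr addrC; exact: HD.
Qed.

Lemma phi_star_le w x c : zero01 w ->
  (forall y, 0 <= y -> x * y - phi w y <= c) -> phi_star w x <= c.
Proof.
move=> w0 H; apply: ge_sup.
  by exists (x * 0 - phi w 0), 0 => //; rewrite phi_star_domE//=.
by move=> _ [y + <-]; rewrite phi_star_domE//= => /H.
Qed.

Lemma phi_star_ge0 w x : zero01 w -> superlog w -> 0 <= phi_star w x.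
Proof.
move=> w0 sw; apply: le_trans (phi_star_ub x w0 sw (lexx 0)).
by rewrite mulr0 phi0// subr0.
Qed.

Lemma phi_star_0 w : zero01 w -> superlog w -> nneg_fun w ->
  phi_star w 0 = 0.
Proof.
move=> w0 sw wge0; apply/eqP; rewrite eq_le phi_star_ge0// andbT.
apply: phi_star_le => // y y0; rewrite mul0r sub0r oppr_le0.
exact/wge0/expR_ge0.
Qed.

(** The supremum runs over nonnegative arguments only; for u < 0 and x >= 0 the left-hand side is at
    most 0, which [phi_star] dominates. *)
Lemma phi_star_ubr w x u : zero01 w -> superlog w ->
    nneg_fun w -> 0 <= x ->
  x * u - phi w u <= phi_star w x.
Proof.
move=> w0 sw wge0 x0; have [u0|u0] := leP 0 u; first exact: phi_star_ub.
apply: le_trans (phi_star_ge0 x w0 sw).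
have : 0 <= phi w u by exact/wge0/expR_ge0.
have : x * u <= 0 by rewrite mulr_ge0_le0// ltW.
lra.
Qed.

(** A supremum of affine functions of x is convex. Log-convexity of the weight sequences and the
    splitting of the index p + q both come from this. *)
Lemma phi_star_midpoint w x y : zero01 w -> superlog w ->
  2 * phi_star w (x + y) <= phi_star w (2 * x) + phi_star w (2 * y).
Proof.
move=> w0 sw; rewrite -ler_pdivlMl//; apply: phi_star_le => // u u0.
rewrite ler_pdivlMl//.
have := phi_star_ub (2 * x) w0 sw u0.
have := phi_star_ub (2 * y) w0 sw u0.
lra.
Qed.

(** Since [phi w] >= 0, multiplying x y - phi w y by c >= 1 subtracts at least as much as the term
    at c x does. This is what makes W^(l) increase with l. *)
Lemma phi_star_scale w c x : zero01 w -> superlog w ->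
    nneg_fun w -> 1 <= c ->
  c * phi_star w x <= phi_star w (c * x).
Proof.
move=> w0 sw wge0 c1; have c0 : 0 < c by rewrite (lt_le_trans _ c1).
rewrite -ler_pdivlMl//; apply: phi_star_le => // u u0.
rewrite ler_pdivlMl//.
have := phi_star_ub (c * x) w0 sw u0.
have : 0 <= phi w u by exact/wge0/expR_ge0.
nra.
Qed.

(** Conjugation reverses the order and turns the factor c into a dilation of the argument; for
    weight matrices this is a change of index, and D becomes a constant factor. *)
Lemma phi_star_compare w v c D x : zero01 w -> zero01 v -> superlog v -> 0 < c ->
    (forall t, 0 <= t -> v t <= c * w t + D) ->
  c * phi_star w (x / c) <= phi_star v x + D.
Proof.
move=> w0 v0 sv c0 vw; rewrite -ler_pdivlMl//; apply: phi_star_le => // u u0.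
rewrite ler_pdivlMl// mulrBr mulrA (mulrC c) divfK ?gt_eqF//.
have := phi_star_ub x v0 sv u0.
have := vw _ (expR_ge0 u); rewrite -!/(phi _ _).
lra.
Qed.

Lemma wmatrix_gt0 w l p : 0 < wmatrix w l p.
Proof. exact: expR_gt0. Qed.

Lemma wmatrix_le w l m p : zero01 w -> superlog w ->
    nneg_fun w -> 0 < l -> l <= m ->
  wmatrix w l p <= wmatrix w m p.
Proof.
move=> w0 sw wge0 l0 lm; have m0 : 0 < m by rewrite (lt_le_trans l0).
rewrite ler_expR.
have c1 : 1 <= m / l by rewrite ler_pdivlMr// mul1r.
have := phi_star_scale (l * p%:R) w0 sw wge0 c1.
rewrite mulrA divfK ?gt_eqF// => H.
by rewrite ler_pdivlMl// mulrA.
Qed.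

Lemma wmatrix_compare w v c D l p : zero01 w -> zero01 v -> superlog v ->
    0 < c -> 0 < l -> (forall t, 0 <= t -> v t <= c * w t + D) ->
  wmatrix w (l / c) p <= expR (D / l) * wmatrix v l p.
Proof.
move=> w0 v0 sv c0 l0 vw; rewrite -expRD ler_expR.
have := phi_star_compare (l * p%:R) w0 v0 sv c0 vw => H.
have -> : l / c * p%:R = l * p%:R / c by rewrite mulrAC.
rewrite invf_div (mulrC c) -(mulrC l^-1) -mulrDr.
by rewrite -(mulrA l^-1) ler_pM2l ?invr_gt0// addrC.
Qed.

End Weights.

(** * Associated weight functions of log-convex sequences *)

Section Omega.
Variable R : realType.
Implicit Types (w v : R -> R) (a b : nat -> R) (x y t l c : R) (p q : nat).

(** Superlinear growth of a = log M, that is, finiteness of the supremum in [omega_of] at every t >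
    0. *)
Definition tempered a := forall y, exists c, forall p, p%:R * y - a p <= c.

Lemma lne_expR a t p : 0 < t ->
  lne (t ^+ p / expR (a p))%:E = (p%:R * ln t - a p)%:E.
Proof.
move=> t0; rewrite lne_EFin ?divr_gt0 ?exprn_gt0 ?expR_gt0//.
by rewrite ln_div ?posrE ?exprn_gt0 ?expR_gt0// expRK lnXn// mulr_natl.
Qed.

(** [omega_of] passes through [fine], which sends infinite values to 0, so the supremum must be kept
    finite on both sides: below by one of its terms, above by [tempered]. *)
Lemma omega_ub a t p : tempered a -> 0 < t ->
  p%:R * ln t - a p <= omega_of (expR \o a) t.
Proof.
move=> ta t0; rewrite /omega_of; set A := [set _ | _ in _].
have ubA : ((p%:R * ln t - a p)%:E <= ereal_sup A)%E.
  by apply: ereal_sup_ubound; exists p => //; exact: lne_expR.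
have [c Hc] := ta (ln t).
have Ac : (ereal_sup A <= c%:E)%E.
  by apply: ge_ereal_sup => _ [q _ <-]; rewrite (lne_expR a q t0) lee_fin.
rewrite -lee_fin fineK// fin_numE; apply/andP; split.
  by apply/eqP => E; rewrite E in ubA.
by apply/eqP => E; rewrite E in Ac.
Qed.

Lemma omega_le a t c : tempered a -> 0 < t ->
  (forall p, p%:R * ln t - a p <= c) -> omega_of (expR \o a) t <= c.
Proof.
move=> ta t0 H; rewrite /omega_of; set A := [set _ | _ in _].
have Ac : (ereal_sup A <= c%:E)%E.
  by apply: ge_ereal_sup => _ [q _ <-]; rewrite (lne_expR a q t0) lee_fin.
have ubA : (-oo < ereal_sup A)%E.
  rewrite (lt_le_trans (ltNyr (0%:R * ln t - a 0%N)))//.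
  by apply: ereal_sup_ubound; exists 0%N => //; exact: lne_expR.
rewrite -lee_fin fineK// fin_numE; apply/andP; split.
  by apply/eqP => E; rewrite E in ubA.
by apply/eqP => E; rewrite E in Ac.
Qed.

Lemma omega_ge0 a t : tempered a -> a 0%N = 0 -> 0 < t -> 0 <= omega_of (expR \o a) t.
Proof.
by move=> ta a0 t0; rewrite (le_trans _ (omega_ub 0 ta t0))// a0 mul0r subr0.
Qed.

Lemma omega_at0 a : a 0%N = 0 -> omega_of (expR \o a) 0 = 0.
Proof.
move=> a0; rewrite /omega_of; set A := [set _ | _ in _].
suff -> : ereal_sup A = 0%E by [].
apply/eqP; rewrite eq_le; apply/andP; split.
  apply: ge_ereal_sup => _ [q _ <-] /=; case: q => [|q].
    by rewrite a0 expR0 divr1 expr0 ler10 ln1.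
  by rewrite expr0n /= mul0r lexx leNye.
apply: ereal_sup_ubound; exists 0%N => //=.
by rewrite a0 expR0 divr1 expr0 ler10 ln1.
Qed.

Lemma omega_eq0 a t : tempered a -> a 0%N = 0 -> (forall p, 0 <= a p) ->
  0 <= t <= 1 -> omega_of (expR \o a) t = 0.
Proof.
move=> ta a0 age0 /andP[]; rewrite le_eqVlt => /predU1P[<- _|t0 t1].
  exact: omega_at0.
apply/eqP; rewrite eq_le omega_ge0// andbT; apply: omega_le => // p.
rewrite lerBlDr add0r (le_trans _ (age0 p))// mulr_ge0_le0//.
exact: ln_le0.
Qed.

Lemma omega_nneg a t : tempered a -> a 0%N = 0 -> 0 <= t ->
  0 <= omega_of (expR \o a) t.
Proof.
move=> ta a0; rewrite le_eqVlt => /predU1P[<-|]; last exact: omega_ge0.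
by rewrite omega_at0.
Qed.

Definition convex_seq a := forall p, 2 * a p.+1 <= a p + a p.+2.

(** The slopes of a convex sequence increase, so q x - a q increases up to p and decreases
    afterwards once x lies between the two slopes at p. The left slope is guarded because it does
    not exist at p = 0. *)
Lemma convex_seq_max a p x : convex_seq a -> x <= a p.+1 - a p ->
    ((0 < p)%N -> a p - a p.-1 <= x) ->
  forall q, q%:R * x - a q <= p%:R * x - a p.
Proof.
move=> ca xp px.
have up n : x <= a (p + n).+1 - a (p + n)%N.
  elim: n => [|n IH]; first by rewrite addn0.
  by rewrite addnS; have := ca (p + n)%N; lra.
have dn n : (n < p)%N -> a (p - n)%N - a (p - n).-1 <= x.
  elim: n => [|n IH] np; first by rewrite subn0; apply: px.
  have := IH (ltnW np).
  have [k pk] : exists k, (p - n = k.+2)%N by exists (p - n).-2; lia.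
  have -> : (p - n.+1 = k.+1)%N by lia.
  by rewrite pk /=; have := ca k; lra.
move=> q; have [qp|pq] := leqP q p.
  have -> : q = (p - (p - q))%N by lia.
  have : (p - q <= p)%N by lia.
  elim: (p - q)%N => [|n IH] np; first by rewrite subn0.
  apply: le_trans (IH (ltnW np)).
  have [k pk] : exists k, (p - n = k.+1)%N by exists (p - n).-1; lia.
  have -> : (p - n.+1 = k)%N by lia.
  have := dn _ np; rewrite pk /= -natr1; nra.
have -> : q = (p + (q - p))%N by lia.
elim: (q - p)%N => [|n IH]; first by rewrite addn0.
apply: le_trans IH; rewrite addnS.
by have := up n; rewrite -natr1; nra.
Qed.

Lemma tempered_argmax a y : tempered a -> a 0%N = 0 ->
  exists p, forall q, q%:R * y - a q <= p%:R * y - a p.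
Proof.
(* The bound at y + 1 gives q y - a q <= c - q, which is negative for q > [N], hence below the value
   0 at the index 0. Only finitely many indices compete. *)
move=> ta a0; have [c Hc] := ta (y + 1).
pose N := Num.bound `|c|.
pose f (i : 'I_N.+1) := i%:R * y - a i.
exists [arg max_(i > ord0) f i]%O => q.
case: arg_maxP => //= i _ Hi.
have [qN|Nq] := ltnP q N.+1; first exact: (Hi (Ordinal qN)).
apply: le_trans (Hi ord0 _) => //.
rewrite /f /= a0 mul0r subr0.
have := Hc q; have := archi_boundP (normr_ge0 c); have := ler_norm c.
have : N.+1%:R <= q%:R :> R by rewrite ler_nat.
by rewrite -natr1 -/N; lra.
Qed.

Lemma legendre_le w v s t : nneg_fun w -> nneg_fun v -> 0 < s -> 0 <= t ->
  legendre w v t <= w s + v (t / s).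
Proof.
move=> w0 v0 s0 t0; apply: ge_inf; last by exists s.
exists 0 => _ [r /= r0 <-]; rewrite addr_ge0 ?w0 ?v0//; first exact: ltW.
by rewrite divr_ge0// ltW.
Qed.

Lemma le_legendre w v t c :
  (forall s, 0 < s -> c <= w s + v (t / s)) -> c <= legendre w v t.
Proof.
move=> H; apply: lb_le_inf; first by exists (w 1 + v (t / 1)), 1 => //=; exact: ltr01.
by move=> _ [r /= r0 <-]; apply: H.
Qed.

Lemma omega_of_mul a b t : tempered a -> tempered b ->
    convex_seq a -> convex_seq b -> a 0%N = 0 -> b 0%N = 0 ->
    (forall p, 0 <= a p) -> (forall p, 0 <= b p) -> 0 <= t ->
  omega_of ((expR \o a) \* (expR \o b)) t =
  legendre (omega_of (expR \o a)) (omega_of (expR \o b)) t.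
Proof.
move=> ta tb ca cb a0 b0 age0 bge0 t0.
have -> : (expR \o a) \* (expR \o b) = expR \o (a \+ b).
  by apply/funext => p /=; rewrite expRD.
have tab : tempered (a \+ b).
  move=> y; have [c Hc] := ta y; exists c => p /=.
  by have := Hc p; have := bge0 p; lra.
have oa t1 : 0 <= t1 -> 0 <= omega_of (expR \o a) t1 by exact: omega_nneg.
have ob t1 : 0 <= t1 -> 0 <= omega_of (expR \o b) t1 by exact: omega_nneg.
move: t0; rewrite le_eqVlt => /predU1P[<-|t0].
  rewrite omega_at0/= ?a0 ?b0 ?addr0//; apply/eqP; rewrite eq_le; apply/andP; split.
    by apply: le_legendre => s s0; rewrite addr_ge0 ?oa ?ob// ?mul0r// ltW.
  apply: le_trans (legendre_le oa ob ltr01 (lexx 0)) _.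
  by rewrite mul0r omega_at0// addr0 omega_eq0// ler01 lexx.
apply/eqP; rewrite eq_le; apply/andP; split.
  apply: le_legendre => s s0; apply: omega_le => // p /=.
  have := omega_ub p ta s0; have := omega_ub p tb (divr_gt0 t0 s0).
  by rewrite ln_div ?posrE//; lra.
have [p Hp] := tempered_argmax (ln t) tab (ltac:(by rewrite /= a0 b0 addr0)).
(* [x] lies between consecutive slopes of [a] at [p], and [ln t - x] between
   those of [b], so that [p] attains all three suprema. *)
have [x [xa xa' xb xb']] : exists x, [/\ x <= a p.+1 - a p,
    (0 < p)%N -> a p - a p.-1 <= x, ln t - x <= b p.+1 - b p &
    (0 < p)%N -> b p - b p.-1 <= ln t - x].
  (* The conditions place x in two intervals, which meet because p is maximal against both
     neighbours; x is the larger of the left endpoints. At the index 0 only the slopes to the right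
     remain. *)
  have H1 := Hp p.+1; rewrite /= -natr1 in H1.
  case: p Hp H1 => [|p] Hp H1 /=.
    by exists (ln t - (b 1%N - b 0%N)); split=> //; lra.
  have H2 := Hp p; rewrite /= -natr1 in H2; rewrite -natr1 in H1.
  have := ca p; have := cb p.
  have [h|h] := leP (a p.+1 - a p) (ln t - (b p.+2 - b p.+1)).
    by exists (ln t - (b p.+2 - b p.+1)); split=> [|_||_]; lra.
  by exists (a p.+1 - a p); split=> [|_||_]; lra.
have s0 : 0 < expR x by exact: expR_gt0.
apply: le_trans (legendre_le oa ob s0 (ltW t0)) _.
have Ep := omega_ub p tab t0.
apply: le_trans Ep => /=.
have : omega_of (expR \o a) (expR x) <= p%:R * x - a p.
  by apply: omega_le => // q; rewrite expRK; apply: convex_seq_max.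
have : omega_of (expR \o b) (t / expR x) <= p%:R * (ln t - x) - b p.
  apply: omega_le => //; first by rewrite divr_gt0.
  by move=> q; rewrite ln_div ?posrE// expRK; apply: convex_seq_max.
lra.
Qed.

End Omega.

(** * Weights, their matrices and the conditions on growth *)

Section Comparison.
Variable R : realType.
Implicit Types (w v : R -> R) (a b : nat -> R) (x y t l c : R) (p q : nat).

Definition log_wmatrix w l := fun p => l^-1 * phi_star w (l * p%:R).

Lemma wmatrixE w l : wmatrix w l = expR \o log_wmatrix w l.
Proof. by []. Qed.

Lemma log_wmatrix_tempered w l : zero01 w -> superlog w -> nneg_fun w -> 0 < l ->
  tempered (log_wmatrix w l).
Proof.
move=> w0 sw wge0 l0 y; exists (l^-1 * phi w y) => p.
rewrite lerBlDr -mulrDr -ler_pdivrMl ?invr_gt0// invrK addrC -lerBlDr.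
by rewrite mulrA phi_star_ubr// mulr_ge0// ltW.
Qed.

Lemma log_wmatrix_convex w l : zero01 w -> superlog w -> 0 < l ->
  convex_seq (log_wmatrix w l).
Proof.
move=> w0 sw l0 p; rewrite /log_wmatrix mulrCA -mulrDr ler_pM2l ?invr_gt0//.
have := phi_star_midpoint (l * p%:R / 2) (l * p.+2%:R / 2) w0 sw.
rewrite !(mulrC 2 (_ / 2)) !divfK//.
by have -> : l * p%:R / 2 + l * p.+2%:R / 2 = l * p.+1%:R by rewrite -!natr1; field.
Qed.

Lemma log_wmatrix_0 w l : zero01 w -> superlog w -> nneg_fun w ->
  log_wmatrix w l 0%N = 0.
Proof. by move=> *; rewrite /log_wmatrix mulr0 phi_star_0// mulr0. Qed.

Lemma log_wmatrix_ge0 w l p : zero01 w -> superlog w -> 0 < l ->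
  0 <= log_wmatrix w l p.
Proof. by move=> *; rewrite mulr_ge0 ?phi_star_ge0// invr_ge0 ltW. Qed.

(** Young's inequality p l y <= [phi_star w (l * p)] + [phi w y] at y = ln t, divided by l: the easy
    half of the equivalence of w with its associated weight functions. *)
Lemma omega_wmatrix_le w l t : zero01 w -> superlog w -> nneg_fun w -> 0 < l ->
  0 <= t -> omega_of (wmatrix w l) t <= l^-1 * w t.
Proof.
move=> w0 sw wge0 l0; rewrite wmatrixE le_eqVlt => /predU1P[<-|t0].
  by rewrite omega_at0 ?log_wmatrix_0// w0 ?mulr0// lexx ler01.
apply: omega_le => //; first exact: log_wmatrix_tempered.
move=> p; rewrite lerBlDr -mulrDr -ler_pdivrMl ?invr_gt0// invrK addrC -lerBlDr.
rewrite mulrA -[t in w t]lnK ?posrE//.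
by rewrite phi_star_ubr// mulr_ge0// ltW.
Qed.

(* The subgradient is the supremum of the slopes of the chords ending at [y]. *)
Lemma W0_subgradient w y : W0 w ->
  exists x, 0 <= x /\ forall z, phi w y + x * (z - y) <= phi w z.
Proof.
move=> ww.
have mono (u v : R) : u <= v -> phi w u <= phi w v.
  by move=> uv; apply: (W0_homo ww); rewrite ?ler_expR// expR_ge0.
pose E := [set (phi w y - phi w z) / (y - z) | z in [set z | z < y]].
have chord (u v : R) : u < y -> y < v ->
    (phi w y - phi w u) / (y - u) <= (phi w v - phi w y) / (v - y).
  move=> uy yv; rewrite ler_pdivrMr ?subr_gt0// mulrAC ler_pdivlMr ?subr_gt0//.
  have vu : 0 < v - u by lra.
  have t0 : 0 <= (v - y) / (v - u) by rewrite divr_ge0; lra.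
  have t1 : (v - y) / (v - u) <= 1 by rewrite ler_pdivrMr; lra.
  have := W0_convex ww (Itv01 t0 t1) (x := u) (y := v).
  rewrite !inE => /(_ Logic.I Logic.I).
  rewrite !convRE /= /conv /= /unstable.onem /GRing.scale /=.
  have -> : (v - y) / (v - u) * u + (1 - (v - y) / (v - u)) * v = y.
    by field; lra.
  set p := phi w y; set a := phi w u; set b := phi w v.
  rewrite -(ler_pM2r vu) => H.
  have : ((v - y) / (v - u) * a + (1 - (v - y) / (v - u)) * b) * (v - u) =
     (v - y) * a + (y - u) * b by field; lra.
  by move=> E1; rewrite E1 in H; nra.
have ubE (v : R) : y < v -> forall e, E e -> e <= (phi w v - phi w y) / (v - y).
  by move=> yv _ [u /= uy <-]; apply: chord.
have Eub : has_ubound E.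
  by exists ((phi w (y + 1) - phi w y) / (y + 1 - y)); apply: ubE; rewrite ltrDl.
have E1 : E ((phi w y - phi w (y - 1)) / (y - (y - 1))).
  by exists (y - 1) => //=; rewrite gtrDl oppr_lt0 ltr01.
exists (sup E); split.
  apply: le_trans (ub_le_sup Eub E1).
  by rewrite divr_ge0 ?subr_ge0 ?mono// gerDl oppr_le0.
move=> z; have [zy|yz|->] := ltgtP z y; last by rewrite subrr mulr0 addr0.
  have : (phi w y - phi w z) / (y - z) <= sup E.
    by apply: ub_le_sup => //; exists z.
  by rewrite ler_pdivrMr ?subr_gt0//; nra.
have : sup E <= (phi w z - phi w y) / (z - y).
  by apply: ge_sup; [exists ((phi w y - phi w (y - 1)) / (y - (y - 1)))|exact: ubE].
by rewrite ler_pdivlMr ?subr_gt0//; nra.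
Qed.

Hint Resolve W0_nneg W0_zero01 W0_superlog : core.

(** A subgradient x of [phi w] at ln t would give equality in Young's inequality. Rounding x / l
    down to an integer p costs at most l ln t, and 2 l ln t <= w t + D lets half of w t pay for it;
    hence the factor 2. *)
Lemma W0_le_omega w l : W0 w -> 0 < l ->
  exists D, forall t, 0 <= t -> w t <= 2 * l * omega_of (wmatrix w l) t + D.
Proof.
move=> ww l0; have [D HD] := W0_superlog ww (2 * l).
have tl : tempered (log_wmatrix w l) by apply: log_wmatrix_tempered; auto.
have l00 : log_wmatrix w l 0%N = 0 by apply: log_wmatrix_0; auto.
exists (Num.max D 0) => t t0.
have [t1|t1] := leP t 1.
  rewrite (W0_zero01 ww) ?t0// addr_ge0 ?le_max ?lexx ?orbT//.
  by rewrite mulr_ge0 ?mulr_ge0 ?(ltW l0)// omega_nneg.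
have t0' : 0 < t by rewrite (lt_trans _ t1).
have y0 : 0 <= ln t by rewrite ln_ge0// ltW.
have [x [x0 Hx]] := W0_subgradient (ln t) ww.
pose p := Num.truncn (x / l).
have /andP[pl pl1] : p%:R <= x / l < p.+1%:R by rewrite truncn_itv// divr_ge0// ltW.
rewrite ler_pdivlMr// in pl; rewrite ltr_pdivrMr// -natr1 in pl1.
have phiE : phi w (ln t) = w t by rewrite /phi lnK.
(* To the right of ln t the smaller slope l p only helps; to the left the slope error, less than l,
   acts over a length of at most ln t. *)
have Hp : phi_star w (l * p%:R) <= l * p%:R * ln t - w t + l * ln t.
  rewrite -phiE; apply: phi_star_le; first by auto.
  move=> z z0; have := Hx z; have [zy|yz] := leP z (ln t); nra.
have := ler_wpM2l (ltW l0) (omega_ub p tl t0').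
rewrite mulrBr mulVKf ?gt_eqF// -wmatrixE.
have := HD _ y0; rewrite phiE.
have : D <= Num.max D 0 by rewrite le_max lexx.
lra.
Qed.

Lemma legendre_nneg w v : nneg_fun w -> nneg_fun v -> nneg_fun (legendre w v).
Proof.
move=> w0 v0 t t0; apply: le_legendre => s s0.
by rewrite addr_ge0 ?w0 ?v0 ?divr_ge0// ltW.
Qed.

Lemma legendre_zero01 w v : zero01 w -> zero01 v -> nneg_fun w -> nneg_fun v ->
  zero01 (legendre w v).
Proof.
move=> w0 v0 wge0 vge0 t t01; have /andP[t0 _] := t01.
apply/eqP; rewrite eq_le legendre_nneg// andbT.
apply: le_trans (legendre_le wge0 vge0 ltr01 t0) _.
by rewrite divr1 v0// w0 ?addr0// ler01 lexx.
Qed.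

(** In the variable y = ln t, [legendre] is the infimal convolution of [phi w] and [phi v]. *)
Lemma legendre_phi w v y u : nneg_fun w -> nneg_fun v ->
  phi (legendre w v) y <= phi w u + phi v (y - u).
Proof.
move=> wge0 vge0; apply: le_trans (legendre_le wge0 vge0 (expR_gt0 u) (expR_ge0 _)) _.
by rewrite /phi expRD expRN.
Qed.

Lemma le_legendre_phi w v y c : (forall u, c <= phi w u + phi v (y - u)) ->
  c <= phi (legendre w v) y.
Proof.
move=> H; apply: le_legendre => s s0.
by have := H (ln s); rewrite /phi expRD expRN lnK.
Qed.

(** In a splitting y = u + (y - u) one part may be negative; the other then exceeds y and suffices
    alone. Absolute values of the constants allow the bound of the idle part to be added all the
    same. *)
Lemma legendre_superlog w v : superlog w -> superlog v -> nneg_fun w -> nneg_fun v ->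
  superlog (legendre w v).
Proof.
move=> sw sv wge0 vge0 c.
have [D HD] := sw `|c|; have [D' HD'] := sv `|c|.
exists (`|D| + `|D'|) => y y0.
rewrite -lerBlDr; apply: le_legendre_phi => u.
have c1 : c * y <= `|c| * y by rewrite ler_wpM2r// ler_norm.
have w1 : 0 <= phi w u by exact/wge0/expR_ge0.
have v1 : 0 <= phi v (y - u) by exact/vge0/expR_ge0.
have := ler_norm D; have := ler_norm D'; have := normr_ge0 D; have := normr_ge0 D'.
have := normr_ge0 c.
have [u0|u0] := leP 0 u; have [yu|yu] := leP 0 (y - u).
- by have := HD _ u0; have := HD' _ yu; nra.
- by have := HD _ u0; nra.
- by have := HD' _ yu; nra.
- by nra.
Qed.

(** Conjugation turns infimal convolution into a sum. A splitting of y may contain a negative part,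
    which is where [phi_star_ubr] and x >= 0 enter. *)
Lemma phi_star_legendre w v x : zero01 w -> zero01 v -> superlog w -> superlog v ->
    nneg_fun w -> nneg_fun v -> 0 <= x ->
  phi_star (legendre w v) x = phi_star w x + phi_star v x.
Proof.
move=> w0 v0 sw sv wge0 vge0 x0.
have L0 := legendre_zero01 w0 v0 wge0 vge0.
have sL := legendre_superlog sw sv wge0 vge0.
apply/eqP; rewrite eq_le; apply/andP; split.
  apply: phi_star_le => // y y0; rewrite lerBlDr addrC -lerBlDr.
  apply: le_legendre_phi => u.
  have := phi_star_ubr u w0 sw wge0 x0.
  by have := phi_star_ubr (y - u) v0 sv vge0 x0; lra.
rewrite -lerBrDr; apply: phi_star_le => // u u0.
rewrite lerBrDr addrC -lerBrDr; apply: phi_star_le => // z z0.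
have := phi_star_ub x L0 sL (addr_ge0 u0 z0).
have := legendre_phi (u + z) u wge0 vge0.
by rewrite (addrC u) addrK; lra.
Qed.

Lemma wmatrix_legendre w v l : zero01 w -> zero01 v -> superlog w -> superlog v ->
    nneg_fun w -> nneg_fun v -> 0 < l ->
  wmatrix (legendre w v) l = wmatrix w l \* wmatrix v l.
Proof.
move=> *; apply/funext => p /=; rewrite /wmatrix -expRD -mulrDr.
by rewrite phi_star_legendre// mulr_ge0// ltW.
Qed.

Lemma superlog_cvgy w : superlog w -> forall c, \forall t \near +oo, c <= w t.
Proof.
move=> sw c; have [D HD] := sw 1.
near=> t.
have t0 : 0 < t by near: t; exact: nbhs_pinfty_gt.
have ct : expR (`|c| + `|D|) <= t by near: t; apply: nbhs_pinfty_ge; exact: num_real.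
have lt : `|c| + `|D| <= ln t by rewrite -ler_expR lnK.
have := HD (ln t); rewrite /phi lnK// mul1r.
have lt0 : 0 <= ln t by rewrite (le_trans _ lt)// addr_ge0.
move=> /(_ lt0); have := ler_norm c; have := ler_norm D; lra.
Unshelve. all: by end_near. Qed.

(** As v tends to infinity, it eventually absorbs the additive constant D. *)
Lemma bigO_compare w v C D : nneg_fun w -> nneg_fun v -> superlog v ->
    (forall t, 0 <= t -> w t <= C * v t + D) ->
  (w : R -> R^o) =O_ (pinfty_nbhs R) (v : R -> R^o).
Proof.
move=> w0 v0 sv H; apply/eqOP.
near=> k; near=> t.
have t0 : 0 <= t by near: t; exact: nbhs_pinfty_ge.
have Dt : D <= v t by near: t; exact: superlog_cvgy.
rewrite !ger0_norm ?w0 ?v0//.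
apply: (le_trans (H t t0)).
have kC : C + 1 <= k by near: k; apply: nbhs_pinfty_ge; exact: num_real.
by have := v0 _ t0; nra.
Unshelve. all: by end_near. Qed.

(** Below the threshold of the asymptotic estimate, monotonicity bounds w (2 t) by a constant; above
    it the estimate applies. Iteration replaces 2 by a power of 2 that exceeds h. *)
Lemma omega1_bound w : W0 w -> omega1 w -> forall h, 1 <= h ->
  exists2 L, 1 <= L & forall t, 0 <= t -> w (h * t) <= L * w t + L.
Proof.
move=> ww /eqOP w1.
have [L L1 HL] : exists2 L, 1 <= L & forall t, 0 <= t -> w (2 * t) <= L * w t + L.
  have [k [_ Hk]] := w1.
  have := Hk (`|k| + 1) (ltr_pwDr ltr01 (ler_norm k)) => -[T [_ HT]].
  have wT := W0_nneg ww (normr_ge0 T).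
  pose L := `|k| + 1 + w (2 * `|T|); exists L.
    rewrite /L; have := normr_ge0 k.
    have : 0 <= w (2 * `|T|) by apply: (W0_nneg ww); rewrite mulr_ge0.
    by lra.
  move=> t t0; have [tT|Tt] := leP t `|T|.
    have : w (2 * t) <= w (2 * `|T|).
      by apply: (W0_homo ww); rewrite ?mulr_ge0// ler_pM2l.
    have := W0_nneg ww t0; have := normr_ge0 k.
    have : 0 <= w (2 * `|T|) by apply: (W0_nneg ww); rewrite mulr_ge0.
    by rewrite /L; nra.
  have := HT t (le_lt_trans (ler_norm T) Tt).
  rewrite (ger0_norm (W0_nneg ww t0)).
  move=> /(le_trans (ler_norm _)); have := W0_nneg ww t0; have := normr_ge0 k.
  have : 0 <= w (2 * `|T|) by apply: (W0_nneg ww); rewrite mulr_ge0.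
  by rewrite /L; nra.
have iterL n : exists2 L', 1 <= L' & forall t, 0 <= t -> w (2 ^+ n * t) <= L' * w t + L'.
  elim: n => [|n [L' L'1 HL']].
    by exists 1 => // t t0; rewrite expr0 !mul1r lerDl.
  exists (L' * L + L'); first nra.
  move=> t t0; rewrite exprSr -mulrA.
  have := HL' (2 * t) (mulr_ge0 (ler0n _ 2) t0); have := HL t t0.
  by have := W0_nneg ww t0; nra.
move=> h h1; pose n := Num.bound h.
have [L' L'1 HL'] := iterL n; exists L' => // t t0.
apply: le_trans (HL' t t0); apply: (W0_homo ww); first by rewrite mulr_ge0// (le_trans _ h1).
rewrite ler_wpM2r// (le_trans (ltW (archi_boundP (le_trans ler01 h1))))//.
by rewrite -natrX ler_nat ltnW// ltn_expl.
Qed.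

(** The dilation by h translates [phi w] by ln h, and the conjugate turns this translation into the
    linear term that yields h^p. The index factor d is the constant of [omega1_bound] and so does
    not depend on l. *)
Lemma wmatrix_omega1 w h : W0 w -> omega1 w -> 1 <= h -> exists2 d, 1 <= d &
  forall l p, 0 < l -> h ^+ p * wmatrix w l p <= expR l^-1 * wmatrix w (d * l) p.
Proof.
move=> ww w1 h1; have [L L1 HL] := omega1_bound ww w1 h1.
exists L => // l p l0.
have L0 : 0 < L by rewrite (lt_le_trans _ L1).
have h0 : 0 < h by rewrite (lt_le_trans _ h1).
rewrite -[h]lnK ?posrE// -expRM_natl -!expRD ler_expR.
set x := l * p%:R.
suff : L * phi_star w x <= phi_star w (L * x) - L * x * ln h + L.
  move=> H; have -> : L * l * p%:R = L * x by rewrite /x mulrA.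
  rewrite -(ler_pM2l (mulr_gt0 L0 l0)) mulrDr.
  have -> : L * l * (p%:R * ln h) = L * x * ln h by rewrite /x; ring.
  have -> : L * l * (l^-1 * phi_star w x) = L * phi_star w x by field; lra.
  rewrite mulrDr.
  have -> : L * l * l^-1 = L by field; lra.
  have -> : L * l * ((L * l)^-1 * phi_star w (L * x)) = phi_star w (L * x) by field; nra.
  by lra.
rewrite -ler_pdivlMl//; apply: phi_star_le; first by auto.
move=> y y0; rewrite ler_pdivlMl//.
have lh0 : 0 <= ln h by rewrite ln_ge0.
have := phi_star_ub (L * x) (W0_zero01 ww) (W0_superlog ww) (addr_ge0 lh0 y0).
have := HL (expR y) (expR_ge0 y).
have -> : w (h * expR y) = phi w (ln h + y) by rewrite /phi expRD lnK.
rewrite -/(phi w y); lra.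
Qed.

(** With t = e^(y - ln H) the condition reads 2 phi(y - ln H) <= phi(y) + H: doubling the weight
    costs a translation, so doubling the index costs only a geometric factor. *)
Lemma wmatrix_omega6 w : W0 w -> omega6 w -> exists2 H, 1 <= H &
  forall l p, 0 < l -> wmatrix w (2 * l) p <= expR (H / (2 * l)) * H ^+ p * wmatrix w l p.
Proof.
move=> ww [H H1 HH]; exists H => // l p l0.
have H0 : 0 < H by rewrite (lt_le_trans _ H1).
rewrite -[H in H ^+ p]lnK ?posrE// -expRM_natl -!expRD ler_expR.
rewrite -(ler_pM2l (mulr_gt0 (ltr0n _ 2) l0)) !mulrDr.
set x := l * p%:R.
have -> : 2 * l * (H / (2 * l)) = H by field; lra.
have -> : 2 * l * (p%:R * ln H) = 2 * x * ln H by rewrite /x; ring.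
rewrite [phi_star _ _ in leRHS]/= -/x.
have -> : 2 * l * (l^-1 * phi_star w x) = 2 * phi_star w x by field; lra.
rewrite mulrA mulfV ?gt_eqF ?mulr_gt0// mul1r -mulrA -/x.
have lH0 : 0 <= ln H by rewrite ln_ge0.
apply: phi_star_le; first by auto.
move=> y y0.
have x0 : 0 <= x by rewrite mulr_ge0// ltW.
(* For y <= ln H the translated point y - ln H may be negative, but there the term 2 x ln H alone
   bounds 2 x y. *)
have [yH|Hy] := leP y (ln H).
  have : 0 <= phi w y by apply: (W0_nneg ww); exact: expR_ge0.
  have := phi_star_ge0 x (W0_zero01 ww) (W0_superlog ww).
  by nra.
have yH0 : 0 <= y - ln H by lra.
have := HH (expR (y - ln H)) (expR_ge0 _).
have -> : H * expR (y - ln H) = expR y by rewrite expRD expRN lnK ?posrE// mulrC divfK// gt_eqF.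
rewrite -!/(phi w _).
have := phi_star_ub x (W0_zero01 ww) (W0_superlog ww) yH0.
lra.
Qed.

End Comparison.

(** * Comparison of weighted spaces *)

Section SupNorms.
Variables (R : realType) (F : fclass R).
Implicit Types (a b : nat -> R) (A B : set (nat -> R)) (f g : fc_vect F).
Local Notation N := (@fc_norm R F).

Definition posw a := forall p, 0 < a p.

Definition dominated a b := exists2 C, 0 < C & forall p, a p <= C * b p.

(** The common shape of the norms of all classes: only the denominator depends on the weight
    sequence, so domination of weights becomes domination of norms. *)
Definition sup_normed := forall i, exists (T : Type) (D : set T)
    (c : fc_vect F -> T -> R) (n : T -> nat), (forall f x, 0 <= c f x) /\
  forall a f, N i a f = ereal_sup [set (c f x / a (n x))%:E | x in D].

Hypothesis HF : sup_normed.

Lemma fc_norm_le i a b C f : posw a -> posw b -> 0 < C ->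
  (forall p, a p <= C * b p) -> (N i b f <= C%:E * N i a f)%E.
Proof.
move=> a0 b0 C0 ab; have [T [D [c [n [c0 NE]]]]] := HF i.
rewrite !NE; apply: ge_ereal_sup => _ [x Dx <-].
apply: (@le_trans _ _ (C%:E * (c f x / a (n x))%:E)%E).
  rewrite -EFinM lee_fin mulrCA ler_wpM2l//.
  by rewrite ler_pdivlMr ?a0// mulrC ler_pdivrMr ?b0.
by rewrite lee_pmul2l ?lte_fin//; apply: ereal_sup_ubound; exists x.
Qed.

(** The value -oo is the supremum over an empty set, which occurs for the empty compact set in the
    class E; [fine] then returns 0. *)
Lemma fc_norm_sign i a f : posw a -> (N i a f = -oo \/ 0 <= N i a f)%E.
Proof.
move=> a0; have [T [D [c [n [c0 NE]]]]] := HF i; rewrite NE.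
have [->|/set0P[x Dx]] := eqVneq D set0; [left|right].
  by rewrite image_set0 ereal_sup0.
apply: (@le_trans _ _ (c f x / a (n x))%:E).
  by rewrite lee_fin divr_ge0// ltW.
by apply: ereal_sup_ubound; exists x.
Qed.

Lemma fine_norm_ge0 i a f : posw a -> 0 <= fine (N i a f).
Proof. by move=> a0; have [->|] := fc_norm_sign i f a0 => //; exact: fine_ge0. Qed.

Lemma fc_norm_lty i a b f : posw a -> posw b -> dominated a b ->
  (N i a f < +oo)%E -> (N i b f < +oo)%E.
Proof.
move=> a0 b0 [C C0 ab] Na; apply: le_lt_trans (fc_norm_le i f a0 b0 C0 ab) _.
have [->|N0] := fc_norm_sign i f a0; first by rewrite gt0_muleNy ?lte_fin// ltNyr.
by rewrite lte_mul_pinfty// lee_fin ltW.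
Qed.

Lemma fine_norm_le i a b C f : posw a -> posw b -> 0 < C ->
    (forall p, a p <= C * b p) -> (N i a f < +oo)%E ->
  fine (N i b f) <= C * fine (N i a f).
Proof.
move=> a0 b0 C0 ab Na; have H := fc_norm_le i f a0 b0 C0 ab.
have [Nb|Nb] := fc_norm_sign i f b0.
  by rewrite Nb mulr_ge0 ?fine_norm_ge0// ltW.
have [Na'|Na'] := fc_norm_sign i f a0.
  by move: H; rewrite Na' gt0_muleNy ?lte_fin// leeNy_eq => /eqP->; rewrite mulr0.
have Nafin : N i a f \is a fin_num by rewrite ge0_fin_numE.
have Nbfin : N i b f \is a fin_num.
  by rewrite ge0_fin_numE//; apply: fc_norm_lty Na => //; exists C.
by rewrite -lee_fin EFinM !fineK.
Qed.

(** Neighbourhoods are given by finite lists of seminorms of g - f, so it suffices to dominate each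
    single seminorm on differences and to shrink the radius along the list. *)
Lemma seminorm_open_sub (V : lmodType R[i]) (E : set V) (Q Q' : set (V -> R)) :
  (forall q, Q q -> exists q' (C : R), [/\ Q' q', 0 < C &
     forall f g : V, E f -> E g -> q (g - f) <= C * q' (g - f)]) ->
  seminorm_open E Q `<=` seminorm_open E Q'.
Proof.
move=> H O [OE Oopen]; split=> // f Of.
have [s [e [sQ e0 Hs]]] := Oopen f Of.
suff [s' [e' [sQ' e0' Hs']]] : exists (s' : seq (V -> R)) (e' : R), [/\ {in s', forall q, Q' q}, 0 < e' &
    forall g : V, E g -> {in s', forall q : V -> R, q (g - f) < e'} ->
      {in s, forall q : V -> R, q (g - f) < e}].
  by exists s', e'; split=> // g Eg sg; apply: Hs => //; apply: Hs'.
elim: s sQ {Hs} => [|q s IH] sQ; first by exists [::], 1.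
have [|s' [e' [sQ' e0' Hs']]] := IH.
  by move=> r rs; apply: sQ; rewrite inE rs orbT.
have [q' [C [Qq' C0 qq']]] := H q (sQ q (mem_head _ _)).
exists (q' :: s'), (Num.min e' (e / C)); split.
- by move=> r; rewrite inE => /predU1P[->//|]; exact: sQ'.
- by rewrite lt_min e0' divr_gt0.
move=> g Eg Hg r; rewrite inE => /predU1P[->|rs].
  have := Hg q' (mem_head _ _); rewrite lt_min => /andP[_].
  rewrite ltr_pdivlMr// mulrC; apply: le_lt_trans; apply: qq' => //.
  exact: OE.
apply: Hs' => // t ts'; have := Hg t; rewrite inE ts' orbT => /(_ isT).
by rewrite lt_min => /andP[].
Qed.

Lemma inductive_set_sub A B i : (forall a, A a -> posw a) -> (forall b, B b -> posw b) ->
    (forall a, A a -> exists2 b, B b & dominated a b) ->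
  inductive_set N (@fc_elem R F) A i `<=` inductive_set N (@fc_elem R F) B i.
Proof.
move=> A0 B0 AB f [a Aa [Ef Nf]]; have [b Bb ab] := AB a Aa.
by exists b => //; split=> //; apply: fc_norm_lty ab Nf; auto.
Qed.

(** Every step of B embeds continuously into a step of A, so continuity on the steps of A restricts.
    The constant of a seminorm carries no sign, hence the absolute value in the proof. *)
Lemma inductive_seminorm_sub A B i :
    (forall a, A a -> posw a) -> (forall b, B b -> posw b) ->
    inductive_set N (@fc_elem R F) A i = inductive_set N (@fc_elem R F) B i ->
    (forall b, B b -> exists2 a, A a & dominated b a) ->
  inductive_seminorm N (@fc_elem R F) A i `<=` inductive_seminorm N (@fc_elem R F) B i.
Proof.
move=> A0 B0 AB BA q [qs Hq]; split; first by rewrite -AB.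
move=> b Bb; have [a Aa [C C0 ba]] := BA b Bb; have [C' HC'] := Hq a Aa.
exists (`|C'| * C) => f [Ef Nf].
have Naf : (N i a f < +oo)%E by apply: fc_norm_lty Nf; auto; exists C.
apply: le_trans (HC' f _) _; first by split.
apply: (@le_trans _ _ (`|C'| * fine (N i a f))).
  by rewrite ler_wpM2r ?ler_norm// fine_norm_ge0//; apply: A0.
by rewrite -mulrA ler_wpM2l// fine_norm_le//; auto.
Qed.

Lemma fspace_Roumieu_eq A B : (forall a, A a -> posw a) -> (forall b, B b -> posw b) ->
    (forall a, A a -> exists2 b, B b & dominated a b) ->
    (forall b, B b -> exists2 a, A a & dominated b a) ->
  fspace F Roumieu A = fspace F Roumieu B.
Proof.
move=> A0 B0 AB BA.
have E i : inductive_set N (@fc_elem R F) A i = inductive_set N (@fc_elem R F) B i.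
  by apply/seteqP; split; apply: inductive_set_sub.
have Q i : inductive_seminorm N (@fc_elem R F) A i =
    inductive_seminorm N (@fc_elem R F) B i.
  by apply/seteqP; split; apply: inductive_seminorm_sub.
rewrite /fspace /proj_inductive_space; congr seminorm_space.
  by apply: eq_set => f; apply: eq_forall => i; rewrite E.
by apply: eq_set => q; apply: eq_exists => i; rewrite Q.
Qed.

(* Needed since [fine] would make an infinite seminorm of [g - f] vanish. *)
Definition norm_sub_closed := forall A f g,
  (exists a, A a) -> (forall a, A a -> posw a) ->
  (forall i a, A a -> step N (@fc_elem R F) i a f) ->
  (forall i a, A a -> step N (@fc_elem R F) i a g) ->
  forall i a, A a -> (N i a (g - f) < +oo)%E.

Hypothesis HB : norm_sub_closed.

Lemma fspace_Beurling_eq A B : (forall a, A a -> posw a) -> (forall b, B b -> posw b) ->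
    (forall a, A a -> exists2 b, B b & dominated b a) ->
    (forall b, B b -> exists2 a, A a & dominated a b) ->
  fspace F Beurling A = fspace F Beurling B.
Proof.
move=> A0 B0 AB BA.
have sub A' B' : (forall a, A' a -> posw a) -> (forall b, B' b -> posw b) ->
    (forall b, B' b -> exists2 a, A' a & dominated a b) ->
    [set f | forall i a, A' a -> step N (@fc_elem R F) i a f] `<=`
    [set f | forall i b, B' b -> step N (@fc_elem R F) i b f].
  move=> A'0 B'0 BA' f Hf i b Bb; have [a Aa ab] := BA' b Bb.
  have [Ef Nf] := Hf i a Aa.
  by split=> //; apply: fc_norm_lty ab Nf; auto.
have E : [set f | forall i a, A a -> step N (@fc_elem R F) i a f] =
    [set f | forall i b, B b -> step N (@fc_elem R F) i b f].
  by apply/seteqP; split; apply: sub.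
rewrite /fspace /projective_space /seminorm_space E; congr LCSpace.
have opens A' B' : (forall a, A' a -> posw a) -> (forall b, B' b -> posw b) ->
    [set f | forall i b, B b -> step N (@fc_elem R F) i b f] =
    [set f | forall i b, B' b -> step N (@fc_elem R F) i b f] ->
    (forall a, A' a -> exists2 b, B' b & dominated b a) ->
    seminorm_open [set f | forall i b, B b -> step N (@fc_elem R F) i b f]
      [set q | exists i a, A' a /\ q = fine \o N i a] `<=`
    seminorm_open [set f | forall i b, B b -> step N (@fc_elem R F) i b f]
      [set q | exists i a, B' a /\ q = fine \o N i a].
  move=> A'0 B'0 E' AB'; apply: seminorm_open_sub => q [i [a [Aa ->]]].
  have [b Bb [C C0 ba]] := AB' a Aa.
  exists (fine \o N i b), C; split=> //; first by exists i, b.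
  rewrite E' => f g Ef Eg /=; apply: fine_norm_le; auto.
  by apply: (HB _ _ Ef Eg) => //; exists b.
by apply/seteqP; split; apply: opens.
Qed.

End SupNorms.

Section ComplexNorm.
Variable R : realType.
Local Notation normc := Normc.normc.

Lemma normc_ge0 (x : R[i]) : 0 <= normc x.
Proof. by case: x => a b; exact: sqrtr_ge0. Qed.

Lemma normc_sub_le (x y : R[i]) : normc (x - y) <= normc x + normc y.
Proof. by rewrite (le_trans (le_normcD _ _))// normcN. Qed.

Lemma ReB (x y : R[i]) : complex.Re (x - y) = complex.Re x - complex.Re y.
Proof. by case: x y => [? ?] [? ?]. Qed.

Lemma ImB (x y : R[i]) : complex.Im (x - y) = complex.Im x - complex.Im y.
Proof. by case: x y => [? ?] [? ?]. Qed.

Lemma ComplexB (a b c d : R) :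
  Complex (a - b) (c - d) = Complex a c - Complex b d :> R[i].
Proof. by []. Qed.

End ComplexNorm.

Section SupSub.
Variables (R : realType) (T : Type) (D : set T).
Implicit Types c d e : T -> R.
Local Notation esup c := (ereal_sup [set (c x)%:E | x in D]).

Lemma ereal_sup_ltyP c : (esup c < +oo)%E <-> exists M, forall x, D x -> c x <= M.
Proof.
split=> [|[M HM]].
  have [->|/set0P[x Dx]] := eqVneq D set0; first by exists 0.
  case E : (esup c) => [r| |] // _.
    exists r => y Dy; rewrite -lee_fin -E; apply: ereal_sup_ubound; by exists y.
  have : ((c x)%:E <= esup c)%E by apply: ereal_sup_ubound; exists x.
  by rewrite E leeNy_eq.
apply: le_lt_trans (ltry M); apply: ge_ereal_sup => _ [x Dx <-].
by rewrite lee_fin HM.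
Qed.

Lemma ereal_sup_sub_lty c d e : (forall x, D x -> c x <= d x + e x) ->
  (esup d < +oo)%E -> (esup e < +oo)%E -> (esup c < +oo)%E.
Proof.
move=> cde /ereal_sup_ltyP[M HM] /ereal_sup_ltyP[M' HM']; apply/ereal_sup_ltyP.
by exists (M + M') => x Dx; rewrite (le_trans (cde x Dx))// lerD ?HM ?HM'.
Qed.

End SupSub.

(** * The classes on open sets *)

Section OpenClasses.
Variables (R : realType) (d : nat) (U : set 'rV[R]_d).
Local Notation C := (R[i]^o).
Local Notation normc := Normc.normc.
Implicit Types (f g : 'rV[R]_d -> C) (K : set 'rV[R]_d).

(** A multi-index becomes a list of directions, the form in which [smooth_on] provides
    derivability. *)
Lemma mpartialE (b : {ffun 'I_d -> nat}) f :
  mpartial b f = foldr (@partial R d) f (flatten [seq nseq (b i) i | i <- enum 'I_d]).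
Proof.
rewrite /mpartial; elim: (enum 'I_d) => //= i s ->.
by rewrite foldr_cat; elim: (b i) => //= n ->.
Qed.

Lemma partialB i f g x :
  derivable (fun x => complex.Re (f x)) x (delta_mx 0 i) ->
  derivable (fun x => complex.Im (f x)) x (delta_mx 0 i) ->
  derivable (fun x => complex.Re (g x)) x (delta_mx 0 i) ->
  derivable (fun x => complex.Im (g x)) x (delta_mx 0 i) ->
  partial i (g - f) x = partial i g x - partial i f x.
Proof.
move=> rf ifi rg ig; rewrite /partial.
have -> : (fun x => complex.Re ((g - f) x)) =
    (fun x => complex.Re (g x)) - (fun x => complex.Re (f x)).
  by apply/funext => y; rewrite /= ReB.
have -> : (fun x => complex.Im ((g - f) x)) =
    (fun x => complex.Im (g x)) - (fun x => complex.Im (f x)).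
  by apply/funext => y; rewrite /= ImB.
rewrite (deriveB rg rf) (deriveB ig ifi); exact: ComplexB.
Qed.

Lemma near_eq_partial i f g x : (\near x, f x = g x) -> partial i f x = partial i g x.
Proof.
move=> fg; rewrite /partial.
congr Complex; apply: near_eq_derive; near=> y; congr (_ _); near: y; exact: fg.
Unshelve. all: by end_near. Qed.

(** A derivative at x depends on the values near x, so the induction keeps the identity at all
    points of the open set U. *)
Lemma foldr_partialB f g (s : seq 'I_d) x : open U -> smooth_on U f -> smooth_on U g ->
    U x ->
  foldr (@partial R d) (g - f) s x = foldr (@partial R d) g s x - foldr (@partial R d) f s x.
Proof.
move=> oU sf sg; elim: s x => [//|i s IH] x Ux /=.
have [_ _ /(_ i)[rf ifi]] := sf s x Ux; have [_ _ /(_ i)[rg ig]] := sg s x Ux.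
rewrite -(partialB rf ifi rg ig); apply: near_eq_partial.
by near=> y; apply: IH; near: y; exact: open_nbhs_nbhs.
Unshelve. all: by end_near. Qed.

Lemma norm_onE K a f : norm_on K a f =
  ereal_sup [set (normc (mpartial u.2 f u.1) / a (morder u.2))%:E |
    u in K `*` [set: {ffun 'I_d -> nat}]].
Proof.
congr ereal_sup; apply/seteqP; split=> y.
  by move=> [x Kx [b _ <-]]; exists (x, b).
by move=> [[x b] [/= Kx _] <-]; exists x => //; exists b.
Qed.

Lemma norm_on_sub_lty K a f g : open U -> K `<=` U -> posw a ->
    smooth_on U f -> smooth_on U g ->
  (norm_on K a f < +oo)%E -> (norm_on K a g < +oo)%E -> (norm_on K a (g - f)%R < +oo)%E.
Proof.
move=> oU KU a0 sf sg; rewrite !norm_onE => Nf Ng.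
apply: ereal_sup_sub_lty Ng Nf => -[x b] [/= Kx _].
rewrite mpartialE foldr_partialB// -?mpartialE; last exact: KU.
by rewrite -mulrDl ler_wpM2r ?normc_sub_le// invr_ge0 ltW.
Qed.

Lemma sup_normed_E : sup_normed (class_E U).
Proof.
move=> [K HK]; exists ('rV[R]_d * {ffun 'I_d -> nat})%type, (K `*` setT).
exists (fun f u => normc (mpartial u.2 f u.1)), (fun u => morder u.2).
by split=> [f u|a f]; [exact: normc_ge0|exact: norm_onE].
Qed.

Lemma sup_normed_B : sup_normed (class_B U).
Proof.
move=> []; exists ('rV[R]_d * {ffun 'I_d -> nat})%type, (U `*` setT).
exists (fun f u => normc (mpartial u.2 f u.1)), (fun u => morder u.2).
by split=> [f u|a f]; [exact: normc_ge0|exact: norm_onE].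
Qed.

Lemma norm_sub_closed_E : open U -> norm_sub_closed (class_E U).
Proof.
move=> oU A f g _ A0 Af Ag [K [cK KU]] a Aa.
have [[sf _] Nf] := Af (exist _ K (conj cK KU)) a Aa.
have [[sg _] Ng] := Ag (exist _ K (conj cK KU)) a Aa.
exact: norm_on_sub_lty (A0 _ Aa) sf sg Nf Ng.
Qed.

Lemma norm_sub_closed_B : open U -> norm_sub_closed (class_B U).
Proof.
move=> oU A f g _ A0 Af Ag [] a Aa.
have [[sf _] Nf] := Af tt a Aa; have [[sg _] Ng] := Ag tt a Aa.
exact: norm_on_sub_lty (A0 _ Aa) sf sg Nf Ng.
Qed.

End OpenClasses.

(** * The classes on the line and of sequences *)

Section LineClass.
Variable R : realType.
Local Notation C := (R[i]^o).
Local Notation normc := Normc.normc.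
Implicit Types f g : R -> C.

Lemma iter_derivCB f g n : smooth_line f -> smooth_line g ->
  iter n (@Defs.derivC R) (g - f) = iter n (@Defs.derivC R) g - iter n (@Defs.derivC R) f.
Proof.
move=> sf sg; elim: n => [//|n IH]; rewrite !iterS IH.
apply/funext => x; have [rf ifi] := sf n x; have [rg ig] := sg n x.
set F := iter n _ f in rf ifi *; set G := iter n _ g in rg ig *.
have derivCE (h : R -> C) : Defs.derivC h x =
    Complex ('D_1 (fun x => complex.Re (h x)) x) ('D_1 (fun x => complex.Im (h x)) x).
  by rewrite /Defs.derivC !derive1E.
change (Defs.derivC (G - F) x = Defs.derivC G x - Defs.derivC F x).
rewrite !derivCE.
have -> : (fun x => complex.Re ((G - F) x)) =
    (fun x => complex.Re (G x)) - (fun x => complex.Re (F x)).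
  by apply/funext => y; rewrite /= ReB.
have -> : (fun x => complex.Im ((G - F) x)) =
    (fun x => complex.Im (G x)) - (fun x => complex.Im (F x)).
  by apply/funext => y; rewrite /= ImB.
rewrite (deriveB rg rf) (deriveB ig ifi); exact: ComplexB.
Qed.

Lemma sup_normed_S : sup_normed (class_S R).
Proof.
move=> []; exists (R * (nat * nat))%type, setT.
exists (fun f u => (1 + `|u.1|) ^+ u.2.2 * normc (iter u.2.1 (@Defs.derivC R) f u.1)).
exists (fun u => (u.2.1 + u.2.2)%N); split=> // f u.
by rewrite mulr_ge0 ?exprn_ge0 ?addr_ge0 ?normc_ge0.
Qed.

Lemma norm_sub_closed_S : norm_sub_closed (class_S R).
Proof.
move=> A f g _ A0 Af Ag [] a Aa.
have [sf Nf] := Af tt a Aa; have [sg Ng] := Ag tt a Aa.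
apply: ereal_sup_sub_lty Ng Nf => u _; rewrite iter_derivCB//.
rewrite -mulrDl ler_wpM2r//; first by rewrite invr_ge0 ltW// A0.
by rewrite -mulrDr ler_wpM2l ?normc_sub_le// exprn_ge0// addr_ge0.
Qed.

Lemma sup_normed_Lambda : sup_normed (class_Lambda R).
Proof.
move=> []; exists nat, setT, (fun c p => normc (c p)), id.
by split=> // f p; exact: normc_ge0.
Qed.

Lemma norm_sub_closed_Lambda : norm_sub_closed (class_Lambda R).
Proof.
move=> A f g _ A0 Af Ag [] a Aa.
have [_ Nf] := Af tt a Aa; have [_ Ng] := Ag tt a Aa.
apply: ereal_sup_sub_lty Ng Nf => p _.
by rewrite -mulrDl ler_wpM2r ?normc_sub_le// invr_ge0 ltW// A0.
Qed.

End LineClass.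

(** * Regularity of complex differentiable functions *)

Section ComplexTopology.
Variable R : realType.
Local Notation C := (R[i]^o).
Local Notation normc := Normc.normc.
Local Notation re := complex.Re.
Local Notation im := complex.Im.
Implicit Types (x y z h k : R[i]) (e d t : R).

Lemma normCE z : `|z| = ((normc z)%:C)%C.
Proof. by case: z => a b; rewrite normc_def. Qed.

Lemma posC_re (e : R[i]) : 0 < e -> exists2 d, 0 < d & e = (d%:C)%C.
Proof.
case: e => a b; rewrite ltcE /= => /andP[/eqP -> a0].
by exists a.
Qed.

Lemma posCE d : (0 < ((d%:C)%C : R[i])) = (0 < d).
Proof. by rewrite ltcR. Qed.

Lemma cvgCP (T : Type) (F : set_system T) (FF : Filter F) (f : T -> C) (l : C) :
  f @ F --> l <-> forall e, 0 < e -> \forall x \near F, normc (l - f x) < e.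
Proof.
split=> [/cvgrPdist_lt H e e0|H].
  have := H ((e%:C)%C); rewrite posCE => /(_ e0); apply: filterS => x.
  by rewrite normCE ltcR.
apply/cvgrPdist_lt => e /posC_re[d d0 ->].
by have := H d d0; apply: filterS => x; rewrite normCE ltcR.
Qed.

Lemma nbhsC z (P : set C) :
  nbhs (z : C) P <-> exists2 d, 0 < d & forall y, normc (z - y) < d -> P y.
Proof.
split=> [/(@nbhs_normP _ C z P)[e /= /posC_re[d d0 ->] H]|[d d0 H]].
  by exists d => // y yd; apply: H; rewrite /= normCE ltcR.
apply/(@nbhs_normP _ C z P); exists ((d%:C)%C) => /=; first by rewrite posCE.
by move=> y /=; rewrite normCE ltcR => /H.
Qed.

Lemma dnbhsC (P : set C) : (\forall h \near (0 : C)^', P h) <->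
  exists2 d, 0 < d & forall h, h != 0 -> normc h < d -> P h.
Proof.
split=> [/nbhsC[d d0 H]|[d d0 H]].
  by exists d => // h h0 hd; apply: H => //; rewrite sub0r normcN.
by apply/nbhsC; exists d => // h; rewrite sub0r normcN => hd h0; apply: H.
Qed.

(** Complex differentiability with real epsilon and delta, because the norm of [R[i]] is itself
    valued in [R[i]]. The large inequality admits h = 0. *)
Definition cdiff (G : C -> C) z l := forall e, 0 < e -> exists2 d, 0 < d &
  forall h, normc h < d -> normc (G (z + h) - G z - l * h) <= e * normc h.

Lemma normc_gt0 z : (0 < normc z) = (z != 0).
Proof.
rewrite lt_neqAle normc_ge0 andbT eq_sym; apply/idP/idP; apply: contra.
  by move=> /eqP ->; rewrite Normc.normc0.
by move=> /eqP/Normc.eq0_normc ->.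
Qed.

Lemma cdiffP (G : C -> C) z l : cdiff G z l <-> is_derive (z : C) (1 : C) G l.
Proof.
have E : cdiff G z l <->
    (fun h : C => h^-1 *: ((G \o shift (z : C)) (h *: 1) - G z)) @ (0 : C)^' --> (l : C).
  have hE (h : C) : h != 0 -> (l - h^-1 *: ((G \o shift (z : C)) (h *: 1) - G z) : C) =
      - (G (z + h) - G z - l * h) / h :> C.
    move=> h0 /=; rewrite /GRing.scale /= mulr1 (addrC h).
    by rewrite opprB mulrBl mulfK// mulrC.
  split=> [H|/cvgCP H e e0].
    apply/cvgCP => e e0; apply/dnbhsC.
    have [d d0 Hd] := H (e / 2) (divr_gt0 e0 (ltr0n _ 2)).
    exists d => // h h0 hd; rewrite hE// Normc.normcM normcN Normc.normcV.
    rewrite ltr_pdivrMr ?normc_gt0// (le_lt_trans (Hd h hd))//.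
    by rewrite ltr_pM2r ?normc_gt0//; lra.
  have /dnbhsC[d d0 Hd] := H e e0; exists d => // h hd.
  have [->|h0] := eqVneq h 0; first by rewrite addr0 subrr mulr0 subrr Normc.normc0 mulr0.
  have := Hd h h0 hd; rewrite hE// Normc.normcM normcN Normc.normcV.
  by rewrite ltr_pdivrMr ?normc_gt0// => /ltW.
rewrite E; split=> [H|[dG <-]]; last exact: dG.
by apply: DeriveDef; [apply/cvg_ex; exists l|exact: cvg_lim].
Qed.

Lemma cdiff_cst k z : cdiff (fun=> k) z 0.
Proof. by apply/cdiffP; exact: is_derive_cst. Qed.

Lemma cdiff_id z : cdiff id z 1.
Proof. by apply/cdiffP; exact: is_derive_id. Qed.

Lemma cdiffB F G z l m : cdiff F z l -> cdiff G z m ->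
  cdiff (fun x => F x - G x) z (l - m).
Proof. by move=> /cdiffP dF /cdiffP dG; apply/cdiffP; exact: is_deriveB. Qed.

Lemma cdiffD F G z l m : cdiff F z l -> cdiff G z m ->
  cdiff (fun x => F x + G x) z (l + m).
Proof. by move=> /cdiffP dF /cdiffP dG; apply/cdiffP; exact: is_deriveD. Qed.

Lemma cdiffM F G z l m : cdiff F z l -> cdiff G z m ->
  cdiff (fun x => F x * G x) z (F z * m + l * G z).
Proof.
move=> /cdiffP dF /cdiffP dG; apply/(cdiffP (fun x => F x * G x) z (F z * m + l * G z)).
by have := is_deriveM dF dG; rewrite /GRing.scale /= (mulrC (G z)).
Qed.

Lemma cdiff_bound G z l : cdiff G z l -> exists2 d, 0 < d & forall h, normc h < d ->
  normc (G (z + h) - G z) <= (1 + normc l) * normc h.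
Proof.
move=> /(_ 1 ltr01)[d d0 H]; exists d => // h /H; rewrite mul1r => Hh.
rewrite mulrDl mul1r -Normc.normcM.
have -> : G (z + h) - G z = (G (z + h) - G z - l * h) + l * h by rewrite subrK.
by rewrite (le_trans (le_normcD _ _))// lerD2r.
Qed.

(** Each of the two error terms receives e / 2; the summands 1 keep the denominators positive when l
    or m vanishes. *)
Lemma cdiff_comp F G z l m : cdiff F z l -> cdiff G (F z) m ->
  cdiff (fun x => G (F x)) z (m * l).
Proof.
move=> dF dG e e0.
have [d1 d10 H1] := cdiff_bound dF.
have nl := normc_ge0 l; have nm := normc_ge0 m.
have [d2 d20 H2] := dG (e / 2 / (1 + normc l)) (divr_gt0 (divr_gt0 e0 (ltr0n _ 2)) (ltr_pwDl ltr01 nl)).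
have [d3 d30 H3] := dF (e / 2 / (1 + normc m)) (divr_gt0 (divr_gt0 e0 (ltr0n _ 2)) (ltr_pwDl ltr01 nm)).
exists (Num.min (Num.min d1 d3) (d2 / (1 + normc l))).
  by rewrite !lt_min d10 d30 divr_gt0//; lra.
move=> h; rewrite !lt_min => /andP[/andP[hd1 hd3]].
rewrite ltr_pdivlMr; last lra.
move=> hd2; have nh := normc_ge0 h.
have B1 := H1 h hd1; have B3 := H3 h hd3.
set k := F (z + h) - F z in B1.
have kd : normc k < d2 by rewrite (le_lt_trans B1)// mulrC.
have := H2 k kd; have -> : F z + k = F (z + h) by rewrite /k addrC subrK.
move=> B2.
have -> : G (F (z + h)) - G (F z) - m * l * h =
   (G (F (z + h)) - G (F z) - m * k) + m * (k - l * h) by ring.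
apply: le_trans (le_normcD _ _) _; rewrite Normc.normcM.
have -> : e * normc h = e / 2 * normc h + e / 2 * normc h by field.
apply: lerD.
  apply: le_trans B2 _.
  have c0 : 0 <= e / 2 / (1 + normc l) by rewrite !divr_ge0 ?addr_ge0// ltW.
  apply: le_trans (ler_wpM2l c0 B1) _.
  by rewrite mulrA divfK//; lra.
apply: le_trans (ler_wpM2l nm B3) _.
have -> : normc m * (e / 2 / (1 + normc m) * normc h) =
  (e / 2 * normc h) * (normc m / (1 + normc m)) by field; lra.
rewrite ler_piMr ?mulr_ge0// ?divr_ge0 ?(ltW e0)//.
by rewrite ler_pdivrMr; lra.
Qed.

End ComplexTopology.

(** * Mean value inequality and complex exponential *)

Section ComplexCalculus.
Variable R : realType.
Local Notation C := (R[i]^o).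
Local Notation normc := Normc.normc.
Local Notation re := complex.Re.
Local Notation im := complex.Im.
Implicit Types (x y z w h k l : R[i]) (e d t : R).

Lemma rdiffP (f : R -> R) (x l : R) :
  (forall e, 0 < e -> exists2 d, 0 < d & forall h : R, `|h| < d ->
     `|f (x + h) - f x - l * h| <= e * `|h|) <-> is_derive x (1 : R) f l.
Proof.
have hE (h : R) : h != 0 -> l - h^-1 *: ((f \o shift x) (h *: 1) - f x) =
    - (f (x + h) - f x - l * h) / h.
  move=> h0 /=; rewrite /GRing.scale /= mulr1 (addrC h).
  by rewrite opprB mulrBl mulfK// mulrC.
split=> [H|[df <-] e e0].
  have {}H : (fun h : R => h^-1 *: ((f \o shift x) (h *: 1) - f x)) @ 0^' --> l.
    apply/cvgrPdist_lt => e e0.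
    have [d d0 Hd] := H (e / 2) (divr_gt0 e0 (ltr0n _ 2)).
    apply/nbhs_normP; exists d => // h /=; rewrite sub0r normrN => hd h0.
    rewrite hE// normrM normrN normfV ltr_pdivrMr ?normr_gt0//.
    by rewrite (le_lt_trans (Hd h hd))// ltr_pM2r ?normr_gt0//; lra.
  by apply: DeriveDef; [apply/cvg_ex; exists l|exact: cvg_lim].
have /cvgrPdist_lt/(_ e e0)/nbhs_normP[d /= d0 Hd] := df.
exists d => // h hd.
have [->|h0] := eqVneq h 0; first by rewrite addr0 subrr mulr0 subrr normr0 mulr0.
have := Hd h; rewrite /= sub0r normrN => /(_ hd h0).
rewrite -[lim _]/('D_1 f x); move: hE; rewrite -[l]/l => _.
have -> : 'D_1 f x - h^-1 *: (f (h *: 1 + x) - f x) =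
    - (f (x + h) - f x - 'D_1 f x * h) / h.
  rewrite /GRing.scale /= mulr1 (addrC h).
  by rewrite opprB mulrBl mulfK// mulrC.
by rewrite normrM normrN normfV ltr_pdivrMr ?normr_gt0// => /ltW.
Qed.

Lemma normc_Re z : `|re z| <= normc z.
Proof. by have := normc_ge_Re z; rewrite normCE lecR. Qed.

Lemma normc_real t : normc ((t%:C)%C : R[i]) = `|t|.
Proof. by rewrite /= expr0n /= addr0 sqrtr_sqr. Qed.

Lemma ReD x y : re (x + y) = re x + re y.
Proof. by case: x y => [? ?] [? ?]. Qed.

Lemma Re_real_mul t z : re ((t%:C)%C * z) = t * re z.
Proof. by case: z => a b /=; rewrite mul0r subr0. Qed.

(* The real part of [k * G] suffices to recover both parts of [G], with
   [k := 1] and [k := - 'i]. *)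
Lemma cdiff_line (G : C -> C) z0 v (x : R) k l : cdiff G (z0 + (x%:C)%C * v) l ->
  is_derive (x : R) (1 : R) (fun t : R => re (k * G (z0 + (t%:C)%C * v))) (re (k * l * v)).
Proof.
move=> dG; apply/rdiffP => e e0.
have nk := normc_ge0 k; have nv := normc_ge0 v.
have p0 : 0 < 1 + normc k * normc v by rewrite ltr_pwDl// mulr_ge0.
have [d d0 Hd] := dG (e / (1 + normc k * normc v)) (divr_gt0 e0 p0).
have q0 : 0 < 1 + normc v by rewrite ltr_pwDl.
exists (d / (1 + normc v)); first by rewrite divr_gt0.
move=> h; rewrite ltr_pdivlMr// => hd.
have hv : normc ((h%:C)%C * v) < d.
  by rewrite Normc.normcM normc_real; have := normr_ge0 h; nra.
have := Hd _ hv; rewrite Normc.normcM normc_real => H.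
have -> : re (k * G (z0 + ((x + h)%:C)%C * v)) - re (k * G (z0 + (x%:C)%C * v)) -
    re (k * l * v) * h =
  re (k * (G (z0 + (x%:C)%C * v + (h%:C)%C * v) - G (z0 + (x%:C)%C * v) - l * ((h%:C)%C * v))).
  have -> : z0 + ((x + h)%:C)%C * v = z0 + (x%:C)%C * v + (h%:C)%C * v.
    by rewrite rmorphD /= mulrDl addrA.
  rewrite (mulrC _ h) -Re_real_mul -!ReB; congr re; ring.
apply: le_trans (normc_Re _) _; rewrite Normc.normcM.
apply: le_trans (ler_wpM2l nk H) _.
have -> : normc k * (e / (1 + normc k * normc v) * (`|h| * normc v)) =
  e * `|h| * ((normc k * normc v) / (1 + normc k * normc v)) by field; lra.
rewrite ler_piMr ?mulr_ge0// ?(ltW e0)//.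
by rewrite ler_pdivrMr; lra.
Qed.

(** With k = conj(z) / |z| a modulus becomes a real part, so the mean value theorem and the integral
    are needed for real functions only. *)
Lemma normc_dual z : exists k, normc k <= 1 /\ re (k * z) = normc z.
Proof.
have [->|z0] := eqVneq z 0.
  by exists 0; rewrite mul0r Normc.normc0 ler01.
have nz : 0 < normc z by rewrite normc_gt0.
exists ((((normc z)^-1)%:C)%C * (z^*)%C); split.
  rewrite Normc.normcM normc_real ger0_norm ?invr_ge0 ?normc_ge0//.
  have -> : normc (z^*)%C = normc z by case: {nz z0} z => a b /=; rewrite sqrrN.
  by rewrite mulVf// gt_eqF.
rewrite -mulrA Re_real_mul.
have -> : re ((z^*)%C * z) = normc z ^+ 2.
  case: {nz z0} z => a b /=; rewrite sqr_sqrtr ?addr_ge0 ?sqr_ge0//.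
  by rewrite mulNr opprK !expr2.
by rewrite expr2 mulKf// gt_eqF.
Qed.

(** The real mean value theorem on the segment from w to z, applied to Re (k G) with k from
    [normc_dual] for the increment of G. *)
Lemma cdiff_mean_value (G G' : C -> C) z w M :
  (forall t, 0 <= t <= 1 -> cdiff G (w + (t%:C)%C * (z - w)) (G' (w + (t%:C)%C * (z - w))) /\
     normc (G' (w + (t%:C)%C * (z - w))) <= M) ->
  normc (G z - G w) <= M * normc (z - w).
Proof.
move=> H; have [k [k1 kE]] := normc_dual (G z - G w).
pose f t := re (k * G (w + (t%:C)%C * (z - w))).
have df t : 0 <= t <= 1 -> is_derive t (1 : R) f
    (re (k * G' (w + (t%:C)%C * (z - w)) * (z - w))).
  by move=> /H[dG _]; exact: cdiff_line.
have [||c c01] := @MVT R f (fun t => re (k * G' (w + (t%:C)%C * (z - w)) * (z - w))) 0 1 ltr01.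
- by move=> t; rewrite in_itv /= => /andP[t0 t1]; apply: df; rewrite !ltW.
- apply: derivable_within_continuous => t; rewrite in_itv /= => t01.
  by have [] := df t t01.
rewrite subr0 mulr1 /f rmorph1 rmorph0 mul1r mul0r addr0 (addrC w) subrK.
rewrite -ReB -mulrBr kE => ->.
apply: le_trans (ler_norm _) _; apply: le_trans (normc_Re _) _.
have G'M : normc (G' (w + (c%:C)%C * (z - w))) <= M.
  by apply: (H c _).2; move: c01; rewrite in_itv /= => /andP[c0 c1]; rewrite !ltW.
rewrite !Normc.normcM ler_wpM2r ?normc_ge0//.
by have := normc_ge0 (G' (w + (c%:C)%C * (z - w))); have := normc_ge0 k; nra.
Qed.

Lemma segment_in_disc z w c t r : normc (z - c) < r -> normc (w - c) < r ->
  0 <= t <= 1 -> normc (w + (t%:C)%C * (z - w) - c) < r.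
Proof.
move=> zr wr /andP[t0 t1].
have -> : w + (t%:C)%C * (z - w) - c =
    ((1 - t)%:C)%C * (w - c) + (t%:C)%C * (z - c) by rewrite rmorphB rmorph1; ring.
apply: le_lt_trans (le_normcD _ _) _; rewrite !Normc.normcM !normc_real.
rewrite !ger0_norm ?subr_ge0//.
pose m := Num.max (normc (z - c)) (normc (w - c)).
apply: (@le_lt_trans _ _ m); last by rewrite gt_max zr.
have : (1 - t) * normc (w - c) <= (1 - t) * m.
  by rewrite ler_wpM2l ?subr_ge0// le_max lexx orbT.
have : t * normc (z - c) <= t * m by rewrite ler_wpM2l// le_max lexx.
lra.
Qed.

Definition cexp z : R[i] := Complex (expR (re z) * cos (im z)) (expR (re z) * sin (im z)).

Lemma cexpD x y : cexp (x + y) = cexp x * cexp y.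
Proof.
case: x y => [a b] [c d]; rewrite /cexp /= expRD cosD sinD.
by apply/eqP; rewrite eq_complex /=; apply/andP; split; apply/eqP; ring.
Qed.

Lemma cexp0 : cexp 0 = 1.
Proof. by rewrite /cexp /= expR0 cos0 sin0 mulr0 mulr1. Qed.

Lemma cexpN z : cexp (- z) = (cexp z)^-1.
Proof.
have E : cexp z * cexp (- z) = 1 by rewrite -cexpD subrr cexp0.
have nz : cexp z != 0.
  by apply: contra_eqN E => /eqP ->; rewrite mul0r eq_sym oner_neq0.
by rewrite -[RHS]mulr1 -E mulKf.
Qed.

Lemma cexp_neq0 z : cexp z != 0.
Proof.
have E : cexp z * cexp (- z) = 1 by rewrite -cexpD subrr cexp0.
by apply: contra_eqN E => /eqP ->; rewrite mul0r eq_sym oner_neq0.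
Qed.

Lemma normc_cexp z : normc (cexp z) = expR (re z).
Proof.
by rewrite /= !exprMn -mulrDr cos2Dsin2 mulr1 sqrtr_sqr ger0_norm// expR_ge0.
Qed.

Lemma normc_le_ReIm z : normc z <= `|re z| + `|im z|.
Proof.
case: z => a b /=; rewrite -[leRHS]ger0_norm ?addr_ge0// -sqrtr_sqr.
rewrite ler_wsqrtr// sqrrD !real_normK ?num_real//.
by have := normr_ge0 a; have := normr_ge0 b; nra.
Qed.

Lemma normc_Im z : `|im z| <= normc z.
Proof.
have -> : im z = re (z * Complex 0 (-1)) by case: z => a b /=; ring.
apply: le_trans (normc_Re _) _; rewrite Normc.normcM /= expr0n /= add0r sqrrN.
by rewrite expr1n sqrtr1 mulr1.
Qed.

Lemma cdiff_cexp0 : cdiff cexp 0 1.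
Proof.
move=> e e0.
(* 9 = 4 + 5, the constants of the real and the imaginary part in [R1] and [R2]. *)
pose e1 := Num.min (e / 9) 1.
have e10 : 0 < e1 by rewrite lt_min ltr01 divr_gt0.
have e11 : e1 <= 1 by rewrite ge_min lexx orbT.
have e17 : 9 * e1 <= e by rewrite mulrC -ler_pdivlMr// ge_min lexx.
clearbody e1.
have [d1 d10 H1] := (rdiffP _ _ _).2 (is_derive_expR (0 : R)) e1 e10.
have [d2 d20 H2] := (rdiffP _ _ _).2 (is_derive_cos (0 : R)) e1 e10.
have [d3 d30 H3] := (rdiffP _ _ _).2 (is_derive_sin (0 : R)) e1 e10.
exists (Num.min (Num.min d1 d2) (Num.min d3 e1)); first by rewrite !lt_min d10 d20 d30 e10.
case=> a b; rewrite !lt_min => /andP[/andP[n1 n2] /andP[n3 n4]].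
set n := normc _ in n1 n2 n3 n4 *.
have an : `|a| <= n := normc_Re (a +i* b)%C; have bn : `|b| <= n := normc_Im (a +i* b)%C.
have {H1} := H1 a (le_lt_trans an n1).
have {H2} := H2 b (le_lt_trans bn n2).
have {H3} := H3 b (le_lt_trans bn n3).
rewrite !add0r expR0 cos0 sin0 oppr0 !mul0r !subr0 ?addr0 !mul1r => Hs Hc He.
rewrite cexp0; apply: le_trans (normc_le_ReIm _) _.
rewrite /cexp /= oppr0 addr0.
have a0 := normr_ge0 a; have b0 := normr_ge0 b.
have ea : `|expR a - 1| <= 2 * n.
  have -> : expR a - 1 = (expR a - 1 - a) + a by ring.
  by apply: le_trans (ler_normD _ _) _; nra.
have ea3 : `|expR a| <= 3.
  have -> : expR a = (expR a - 1) + 1 by ring.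
  by apply: le_trans (ler_normD _ _) _; rewrite normr1; nra.
have -> : expR a * cos b - 1 - a = expR a * (cos b - 1) + (expR a - 1 - a) by ring.
have -> : expR a * sin b - b = expR a * (sin b - b) + (expR a - 1) * b by ring.
have n0 : 0 <= n by exact: le_trans an.
have n4' : n <= e1 by exact: ltW.
have R1 : `|expR a * (cos b - 1) + (expR a - 1 - a)| <= 4 * e1 * n.
  apply: le_trans (ler_normD _ _) _; rewrite normrM.
  have : `|expR a| * `|cos b - 1| <= 3 * (e1 * n).
    by apply: ler_pM => //; apply: le_trans Hc _; rewrite ler_wpM2l// ltW.
  have : e1 * `|a| <= e1 * n by rewrite ler_wpM2l// ltW.
  lra.
have R2 : `|expR a * (sin b - b) + (expR a - 1) * b| <= 5 * e1 * n.
  apply: le_trans (ler_normD _ _) _; rewrite !normrM.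
  have : `|expR a| * `|sin b - b| <= 3 * (e1 * n).
    by apply: ler_pM => //; apply: le_trans Hs _; rewrite ler_wpM2l// ltW.
  have : `|expR a - 1| * `|b| <= 2 * n * e1 by apply: ler_pM => //; exact: le_trans n4'.
  lra.
by nra.
Qed.

Lemma cdiff_cexp z : cdiff cexp z (cexp z).
Proof.
move=> e e0; have n0 := normc_cexp z; have ez := expR_gt0 (re z).
have [d d0 H] := cdiff_cexp0 (divr_gt0 e0 ez).
exists d => // h hd; have := H h hd; rewrite add0r cexp0 mul1r => {}H.
have -> : cexp (z + h) - cexp z - cexp z * h = cexp z * (cexp h - 1 - h).
  by rewrite cexpD; ring.
rewrite Normc.normcM n0 -ler_pdivlMl// (le_trans H)// mulrA.
by rewrite (mulrC e).
Qed.

End ComplexCalculus.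

(** * Integrals over circles *)

Section CircleMean.
Variable R : realType.
Implicit Types (f g : R -> R) (A B a : R -> R -> R).
Local Notation mu := (@lebesgue_measure R).
Local Notation T := (pi *+ 2 : R).

Definition circ f : R := \int[mu]_(t in `[0, T]) f t.

Lemma T_gt0 : 0 < T.
Proof. by rewrite mulrn_wgt0// pi_gt0. Qed.

Lemma circ_integrable f : continuous f -> mu.-integrable `[0, T] (EFin \o f).
Proof.
move=> cf; apply: continuous_compact_integrable; first exact: segment_compact.
exact: continuous_subspaceT.
Qed.

Lemma mu_circ : fine (mu `[0, T]) = T.
Proof. by rewrite lebesgue_measure_itv /= lte_fin T_gt0 oppr0 addr0. Qed.

Lemma circB f g : continuous f -> continuous g ->
  circ (fun t => f t - g t) = circ f - circ g.
Proof. by move=> cf cg; apply: RintegralB => //; exact: circ_integrable. Qed.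

Lemma circZ f (r : R) : continuous f -> circ (fun t => r * f t) = r * circ f.
Proof. by move=> cf; apply: RintegralZl => //; exact: circ_integrable. Qed.

Lemma circ_cst (r : R) : circ (fun=> r) = r * T.
Proof. by rewrite /circ Rintegral_cst// mu_circ. Qed.

Lemma circ_bound f (M : R) : continuous f -> (forall t, `|f t| <= M) ->
  `|circ f| <= M * T.
Proof.
move=> cf fM; apply: le_trans (le_normr_Rintegral _ (circ_integrable cf)) _ => //.
rewrite -circ_cst; apply: le_Rintegral => //.
- by have := circ_integrable cf => /integrable_norm.
- by apply: (@circ_integrable (fun=> M)); exact: cst_continuous.
Qed.

(* The derivative need not be continuous: this rests on dominated convergence. *)
Lemma circ_derive A a (M s0 s1 : R) :
  (forall s t, s0 < s < s1 -> is_derive s (1 : R) (A ^~ t) (a s t)) ->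
  (forall s t, s0 < s < s1 -> `|a s t| <= M) ->
  (forall s, s0 < s < s1 -> continuous (A s)) ->
  forall s, s0 < s < s1 -> is_derive s (1 : R) (fun s => circ (A s)) (circ (a s)).
Proof.
move=> dA aM cA s s01.
have Is : `]s0, s1[%classic s by rewrite /= in_itv.
have iA x : `]s0, s1[%classic x -> mu.-integrable `[0, T] (EFin \o A x).
  by rewrite /= in_itv /= => x01; apply/circ_integrable/cA.
have dA1 x y : `]s0, s1[%classic x -> `[0, T]%classic y -> derivable (A ^~ y) x 1.
  by rewrite /= in_itv /= => x01 _; have [] := dA x y x01.
have pE x y : s0 < x < s1 -> partial1of2 A x y = a x y.
  by move=> x01; rewrite partial1of2E; have [_ ->] := dA x y x01.
have M0 (y : R) : 0 <= (fun=> `|M|) y :> R by exact: normr_ge0.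
have iM : mu.-integrable `[0, T] (EFin \o (fun=> `|M|)).
  by apply: (@circ_integrable (fun=> `|M|)); exact: cst_continuous.
have bM x y : `]s0, s1[%classic x -> `[0, T]%classic y ->
    `|partial1of2 A x y| <= (fun=> `|M|) y.
  rewrite /= in_itv /= => x01 _; rewrite pE//.
  by rewrite (le_trans (aM x y x01))// ler_norm.
have mT : measurable `[0, T]%classic by exact: measurable_itv.
have dF := @derivable_under_integral R _ _ mu A _ mT s s0 s1 Is iA dA1 _ M0 iM bM.
have vF := @differentiation_under_integral R _ _ mu A _ mT s s0 s1 Is iA dA1 _ M0 iM bM.
apply: DeriveDef; first exact: dF.
rewrite -derive1E; rewrite /circ; apply: etrans vF _.
by apply: eq_Rintegral => y _; rewrite pE.
Qed.

Lemma derivable_cont f df : (forall x, is_derive x (1 : R) f (df x)) -> continuous f.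
Proof.
move=> d x; apply: differentiable_continuous; apply/derivable1_diffP.
by have [] := d x.
Qed.

Lemma is_derive_translate f (x y l : R) : is_derive (y + x) (1 : R) f l ->
  is_derive y (1 : R) (fun t => f (t + x)) l.
Proof.
move=> /rdiffP H; apply/rdiffP => e /H[d d0 Hd]; exists d => // h /Hd.
by have -> : y + x + h = y + h + x by rewrite addrAC.
Qed.

(** The derivative is bounded but possibly discontinuous, so it is not integrated directly. Instead
    the integral of f(t + x) over a period is differentiated at x = 0 in two ways: under the
    integral, giving the integral of [df], and through a primitive of f, giving f(T) - f(0) = 0. *)
Lemma circ_derive_periodic f (df : R -> R) (M : R) :
  (forall x, is_derive x (1 : R) f (df x)) -> (forall x, `|df x| <= M) ->
  (forall x, f (x + T) = f x) -> circ df = 0.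
Proof.
move=> dfx dfM fT; have cf := derivable_cont dfx.
have df_shift x t : is_derive t (1 : R) (fun t => f (t + x)) (df (t + x)).
  exact: is_derive_translate.
have K' : is_derive 0 (1 : R) (fun x => circ (fun t => f (t + x))) (circ (fun t => df (t + 0))).
  apply: (@circ_derive (fun x t => f (t + x)) (fun x t => df (t + x)) M (-1) 1).
  - move=> s t _; have -> : (fun s => f (t + s)) = (fun s => f (s + t)).
      by apply/funext => u; rewrite addrC.
    by rewrite addrC; exact: is_derive_translate.
  - by move=> s t _; exact: dfM.
  - by move=> s _; exact: derivable_cont (df_shift s).
  - by rewrite ltrN10 ltr01.
(* The base point -2 makes P differentiable at t + x for all t >= 0 and x > -1, that is, for x on
   both sides of 0. *)
pose P (y : R) : R := \int[mu]_(t in `[-2, y]) f t.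
have dP (y : R) : -2 < y -> is_derive y (1 : R) P (f y).
  move=> y2.
  have yy : y < y + 1 by rewrite ltrDl.
  have fi : mu.-integrable `[-2, (y + 1)] (EFin \o f).
    apply: continuous_compact_integrable; first exact: segment_compact.
    exact: continuous_subspaceT.
  have [dPy Py] := continuous_FTC1_closed yy fi y2 (cf y).
  by apply: DeriveDef; [exact: dPy|rewrite -derive1E; exact: Py].
have KP (x : R) : -1 < x -> circ (fun t => f (t + x)) = P (T + x) - P (0 + x).
  move=> x1.
  have dPx (t : R) : 0 <= t -> is_derive t (1 : R) (fun t => P (t + x)) (f (t + x)).
    by move=> t0; apply: is_derive_translate; apply: dP; lra.
  have cPx (t : R) : 0 <= t -> {for t, continuous (fun t => P (t + x))}.
    move=> t0; apply: differentiable_continuous; apply/derivable1_diffP.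
    by have [] := dPx t t0.
  rewrite /circ /Rintegral.
  rewrite (@continuous_FTC2 R (fun t => f (t + x)) (fun t => P (t + x)) 0 T) //.
  - exact: T_gt0.
  - by apply: continuous_subspaceT; exact: derivable_cont (df_shift x).
  - split=> [t||].
    + by rewrite in_itv /= => /andP[t0 _]; have [] := dPx t (ltW t0).
    + by apply: cvg_at_right_filter; apply: cPx.
    + by apply: cvg_at_left_filter; apply: cPx; rewrite ltW ?T_gt0.
  - move=> t; rewrite in_itv /= => /andP[t0 _].
    by rewrite derive1E; have [_ ->] := dPx t (ltW t0).
have K0 : is_derive 0 (1 : R) (fun x => circ (fun t => f (t + x))) (f (T + 0) - f (0 + 0)).
  apply: (@near_eq_is_derive R _ _ (fun x => P (x + T) - P x)).
    apply/nbhs_normP; exists 1; first exact: ltr01.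
    move=> x /=; rewrite sub0r normrN ltr_norml => /andP[x1 _].
    by rewrite KP// add0r (addrC T).
  have T0 := T_gt0.
  apply: is_deriveB; first by apply: is_derive_translate; rewrite addrC; apply: dP; lra.
  by rewrite addr0; apply: dP; lra.
have [_ E1] := K'; have [_ E2] := K0; move: E1; rewrite E2.
rewrite addr0 -[T in f T]add0r fT addr0 subrr => ->.
by congr circ; apply/funext => t; rewrite addr0.
Qed.

(* [A] and [B] satisfy one of the two Cauchy-Riemann equations. *)
Lemma circ_mean_const A B a (M s1 : R) :
  (forall s t, s < s1 -> is_derive s (1 : R) (A ^~ t) (a s t)) ->
  (forall s t, s < s1 -> is_derive t (1 : R) (B s) (a s t)) ->
  (forall s t, s < s1 -> `|a s t| <= M) ->
  (forall s, s < s1 -> continuous (A s)) ->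
  (forall s t, B s (t + T) = B s t) ->
  forall s r, s < s1 -> r < s1 -> circ (A s) = circ (A r).
Proof.
move=> dA dB aM cA BT.
(* The s-derivative of the mean of A is the mean of [a s], which is the t-derivative of the periodic
   function [B s] and so has mean 0. *)
have dF (s : R) : s < s1 -> is_derive s (1 : R) (fun s => circ (A s)) 0.
  move=> ss1; have <- : circ (a s) = 0.
    by apply: (@circ_derive_periodic (B s) (a s) M); auto.
  apply: (@circ_derive A a M (s - 1) s1).
  - by move=> x t /andP[_]; exact: dA.
  - by move=> x t /andP[_]; exact: aM.
  - by move=> x /andP[_]; exact: cA.
  - by rewrite ss1 gtrDl ltrN10.
have main (s r : R) : s < r -> r < s1 -> circ (A s) = circ (A r).
  move=> sr rs1.
  have [||c _] := @MVT R (fun s => circ (A s)) (fun=> 0) s r sr.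
  - by move=> x; rewrite in_itv /= => /andP[_ xr]; apply: dF; exact: lt_trans rs1.
  - apply: derivable_within_continuous => x; rewrite in_itv /= => /andP[_ xr].
    by have [] := dF x (le_lt_trans xr rs1).
  by rewrite mul0r => /eqP; rewrite subr_eq0 => /eqP ->.
move=> s r ss rs; have [sr|rs'|->//] := ltgtP s r; first exact: main.
by apply/esym/main.
Qed.

End CircleMean.

(** * The derivative as a circle mean *)

Section Regularity.
Variable R : realType.
Local Notation C := (R[i]^o).
Local Notation normc := Normc.normc.
Local Notation re := complex.Re.
Local Notation im := complex.Im.
Local Notation T := (pi *+ 2 : R).
Implicit Types (x y z w h k l : R[i]) (e d t s : R).

Lemma continuous_subr (f g : R -> R) : continuous f -> continuous g ->
  continuous (fun t => f t - g t).
Proof.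
move=> cf cg t; apply: (@cvgB R R R (nbhs t) _ f g); [exact: cf|exact: cg].
Qed.

Lemma Complex_re_line s t : Complex s t = Complex 0 t + (s%:C)%C * 1 :> R[i].
Proof. by apply/eqP; rewrite eq_complex /=; apply/andP; split; apply/eqP; ring. Qed.

Lemma Complex_im_line s t : Complex s t = Complex s 0 + (t%:C)%C * Complex 0 1 :> R[i].
Proof. by apply/eqP; rewrite eq_complex /=; apply/andP; split; apply/eqP; ring. Qed.

Lemma cexp_periodic s t : cexp (Complex s (t + T)) = cexp (Complex s t).
Proof. by rewrite /cexp /= cosD sinD cos2pi sin2pi !mulr1 !mulr0 subr0 addr0. Qed.

Lemma Re_mul_le k z (M : R) : normc z <= M -> `|re (k * z)| <= normc k * M.
Proof.
move=> zM; rewrite (le_trans (normc_Re _))// Normc.normcM.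
by rewrite ler_wpM2l// normc_ge0.
Qed.

Variables (G G' : C -> C) (c : R[i]) (r M : R).
Hypothesis HG : forall z, normc (z - c) < r -> cdiff G z (G' z) /\ normc (G' z) <= M.

Let lip z w : normc (z - c) < r -> normc (w - c) < r ->
  normc (G z - G w) <= M * normc (z - w).
Proof.
move=> zr wr; apply: (@cdiff_mean_value R G G') => t t01.
by apply: HG; apply: segment_in_disc.
Qed.

(** The difference quotient with increment e^u. For u = s + i t the radius is e^s and t is the
    angle; in u the quotient is differentiable without a singularity at increment 0. *)
Definition cquot z (u : R[i]) : R[i] := (G (z + cexp u) - G z) * cexp (- u).

Let in_disc z u : normc (z - c) + expR (re u) < r -> normc (z + cexp u - c) < r.
Proof.
move=> H; rewrite addrAC; apply: le_lt_trans (le_normcD _ _) _.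
by rewrite normc_cexp.
Qed.

Let in_disc0 z u : normc (z - c) + expR (re u) < r -> normc (z - c) < r.
Proof. by move=> H; rewrite (lt_trans _ H)// ltrDl expR_gt0. Qed.

Let M_ge0 z : normc (z - c) < r -> 0 <= M.
Proof. by move=> /HG[_]; apply: le_trans; exact: normc_ge0. Qed.

Let quot' z u : R[i] :=
  (G (z + cexp u) - G z) * (cexp (- u) * (0 - 1)) +
  (G' (z + cexp u) * (0 + cexp u) - 0) * cexp (- u).

Let cdiff_quot z u : normc (z - c) + expR (re u) < r -> cdiff (cquot z) u (quot' z u).
Proof.
move=> zu; have [dG _] := HG (in_disc zu).
apply: (@cdiffM R (fun u => G (z + cexp u) - G z) (fun u => cexp (- u))).
  apply: cdiffB; last exact: cdiff_cst.
  apply: (@cdiff_comp R (fun u => z + cexp u) G) => //.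
  by apply: cdiffD; [exact: cdiff_cst|exact: cdiff_cexp].
apply: (@cdiff_comp R (fun u => - u) (@cexp R)); last exact: cdiff_cexp.
rewrite (_ : (fun u => - u) = (fun u : C => 0 - u)); last by apply/funext => v; rewrite sub0r.
by apply: cdiffB; [exact: cdiff_cst|exact: cdiff_id].
Qed.

Let quot'_le z u : normc (z - c) + expR (re u) < r -> normc (quot' z u) <= 2 * M.
Proof.
move=> zu; have [_ G'M] := HG (in_disc zu).
have G1 := lip (in_disc zu) (in_disc0 zu).
rewrite [X in normc (X - z)]addrC addrK normc_cexp in G1.
rewrite /quot' sub0r mulrN1 add0r subr0.
apply: le_trans (le_normcD _ _) _.
rewrite mulrN normcN !Normc.normcM !normc_cexp.
have -> : re (- u) = - re u by case: u {zu G1 G'M}.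
have e1 : expR (re u) * expR (- re u) = 1 by rewrite -expRD subrr expR0.
have e0 := expR_gt0 (- re u).
rewrite -mulrA e1 mulr1 mulr2n mulrDl mul1r; apply: lerD => //.
apply: le_trans (ler_wpM2r (ltW e0) G1) _.
by rewrite -mulrA e1 mulr1.
Qed.

Let cont_quot z k s : normc (z - c) + expR s < r ->
  continuous (fun t => re (k * cquot z (Complex s t))).
Proof.
move=> zs; apply: (@derivable_cont R _ (fun t => re (k * quot' z (Complex s t) * Complex 0 1))).
move=> t; rewrite (_ : (fun t => _) =
    (fun t : R => re (k * cquot z (Complex s 0 + (t%:C)%C * Complex 0 1)))); last first.
  by apply/funext => v; rewrite -Complex_im_line.
by apply: cdiff_line; rewrite -Complex_im_line; apply: cdiff_quot.
Qed.

(* The circle mean of the difference quotient does not depend on the radius and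
   tends to [G' z] as the radius tends to 0. *)
Lemma circ_quot z k s : normc (z - c) + expR s < r ->
  circ (fun t => re (k * cquot z (Complex s t))) = re (k * G' z) * T.
Proof.
move=> zs; have zr : normc (z - c) < r by rewrite (lt_trans _ zs)// ltrDl expR_gt0.
have r0 : 0 < r - normc (z - c) by rewrite subr_gt0.
pose s1 := ln (r - normc (z - c)).
have zs1 (s' : R) : s' < s1 -> normc (z - c) + expR s' < r.
  by rewrite -ltr_expR lnK// ltrBrDl.
have ss1 : s < s1 by rewrite -ltr_expR lnK// ltrBrDl.
have const (s' : R) : s' < s1 -> circ (fun t => re (k * cquot z (Complex s t))) =
    circ (fun t => re (k * cquot z (Complex s' t))).
  move=> s's1.
  (* Multiplication by -i turns the real part into the imaginary part, so the second function is Im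
     (k cquot), whose t-derivative is the s-derivative of Re (k cquot). *)
  apply: (@circ_mean_const R (fun s t => re (k * cquot z (Complex s t)))
    (fun s t => re (k * Complex 0 (-1) * cquot z (Complex s t)))
    (fun s t => re (k * quot' z (Complex s t))) (normc k * (2 * M)) s1) => //.
  - move=> x t xs1; rewrite (_ : (fun s => _) =
      (fun s : R => re (k * cquot z (Complex 0 t + (s%:C)%C * 1)))); last first.
      by apply/funext => v; rewrite -Complex_re_line.
    rewrite -[k * quot' _ _]mulr1; apply: cdiff_line.
    by rewrite -Complex_re_line; apply/cdiff_quot/zs1.
  - move=> x t xs1; rewrite (_ : (fun t => _) =
      (fun t : R => re (k * Complex 0 (-1) * cquot z (Complex x 0 + (t%:C)%C * Complex 0 1)))).
      rewrite (_ : k * quot' _ _ =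
          k * Complex 0 (-1) * quot' z (Complex x t) * Complex 0 1); last first.
        have i1 : Complex 0 (-1) * Complex 0 1 = 1 :> R[i].
          by apply/eqP; rewrite eq_complex /=; apply/andP; split; apply/eqP; ring.
        by rewrite mulrAC -(mulrA k) i1 mulr1.
      by apply: cdiff_line; rewrite -Complex_im_line; apply/cdiff_quot/zs1.
    by apply/funext => v; rewrite -Complex_im_line.
  - by move=> x t xs1; apply/Re_mul_le/quot'_le/zs1.
  - by move=> x xs1; apply/cont_quot/zs1.
  - by move=> x t; rewrite /cquot !cexpN !cexp_periodic.
apply/eqP; rewrite -subr_eq0 -normr_le0; apply/ler_addgt0Pl => e e0; rewrite addr0.
have [dG _] := HG zr.
have k0 : 0 < (1 + normc k) * T by rewrite mulr_gt0 ?T_gt0// ltr_pwDl// normc_ge0.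
have [d d0 Hd] := dG (e / ((1 + normc k) * T)) (divr_gt0 e0 k0).
(* A radius below d brings the quotient within e / ((1 + |k|) T) of G' z; subtracting 1 makes both
   inequalities strict. *)
pose s' := Num.min (s1 - 1) (ln d - 1).
have s's1 : s' < s1 by rewrite gt_min gtrDl ltrN10.
have s'd : expR s' < d.
  by rewrite -[d in ltRHS]lnK// ltr_expR gt_min gtrDl ltrN10 orbT.
rewrite (const s' s's1) -circ_cst -circB; last 2 first.
- by apply/cont_quot/zs1.
- exact: cst_continuous.
have c1 := @cont_quot z k s' (zs1 s' s's1).
have c2 : continuous (fun t => re (k * cquot z (Complex s' t)) - re (k * G' z)).
  by apply: continuous_subr => //; exact: cst_continuous.
apply: le_trans (circ_bound (M := normc k * (e / ((1 + normc k) * T))) c2 _) _.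
  move=> t; rewrite -ReB -mulrBr; apply: Re_mul_le.
  pose u : R[i] := Complex s' t.
  have -> : cquot z u - G' z = (G (z + cexp u) - G z - G' z * cexp u) * cexp (- u).
    by rewrite mulrBl -(mulrA _ (cexp u)) -cexpD subrr cexp0 mulr1.
  have := Hd (cexp u); rewrite normc_cexp => /(_ s'd) H.
  rewrite Normc.normcM normc_cexp /= expRN ler_pdivrMr ?expR_gt0//.
have -> : normc k * (e / ((1 + normc k) * T)) * T = e * (normc k / (1 + normc k)).
  have := T_gt0 R; have := normc_ge0 k => ? ?; field.
  by apply/andP; split; rewrite gt_eqF//; lra.
rewrite ler_piMr ?(ltW e0)// ler_pdivrMr; have := normc_ge0 k; lra.
Qed.

Let cquotB_le z w (rho : R) u : 0 < rho -> expR (re u) = rho ->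
    normc (z - c) + rho < r -> normc (w - c) + rho < r ->
  normc (cquot z u - cquot w u) <= 2 * M / rho * normc (z - w).
Proof.
move=> rho0 urho zr wr; rewrite -urho in zr wr.
have H1 := lip (in_disc zr) (in_disc wr); have H2 := lip (in_disc0 zr) (in_disc0 wr).
rewrite (_ : z + cexp u - (w + cexp u) = z - w) in H1; last by ring.
rewrite /cquot -mulrBl Normc.normcM normc_cexp.
have -> : re (- u) = - re u by case: u {zr wr H1 urho}.
rewrite expRN urho mulrAC ler_pM2r ?invr_gt0//.
have -> : G (z + cexp u) - G z - (G (w + cexp u) - G w) =
  (G (z + cexp u) - G (w + cexp u)) - (G z - G w) by ring.
by apply: le_trans (normc_sub_le _ _) _; lra.
Qed.

(** G' is the mean of the quotient over a circle of fixed radius rho, and there the quotient is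
    Lipschitz in z with constant 2 M / rho. The radius rho = r / 2 keeps the circles inside the disc
    and gives 4 M / r. *)
Lemma cdiff_deriv_lipschitz z w : normc (z - c) < r / 2 -> normc (w - c) < r / 2 ->
  normc (G' z - G' w) <= 4 * M / r * normc (z - w).
Proof.
move=> zr wr; have r0 : 0 < r by have := normc_ge0 (z - c); lra.
have rho0 : 0 < r / 2 by lra.
have e1 : expR (ln (r / 2)) = r / 2 by rewrite lnK.
have zr' : normc (z - c) + expR (ln (r / 2)) < r by rewrite e1; lra.
have wr' : normc (w - c) + expR (ln (r / 2)) < r by rewrite e1; lra.
have [k [k1 <-]] := normc_dual (G' z - G' w).
rewrite -(ler_pM2r (T_gt0 R)) mulrBr ReB mulrBl -!(circ_quot _ zr', circ_quot _ wr').
have c1 := @cont_quot z k _ zr'; have c2 := @cont_quot w k _ wr'.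
rewrite -circB//; apply: le_trans (ler_norm _) _; apply: circ_bound.
  exact: continuous_subr.
move=> t; rewrite -ReB -mulrBr.
have H := @cquotB_le z w (r / 2) (Complex (ln (r / 2)) t) rho0 e1.
apply: le_trans (Re_mul_le k (H _ _)) _; [lra|lra|].
have -> : 4 * M / r = 2 * M / (r / 2) by field; lra.
by rewrite ler_piMl// (le_trans (normc_ge0 _) (H _ _)); lra.
Qed.

(** The mean value inequality for x -> G x - G' w x, whose derivative G' x - G' w is at most the
    Lipschitz constant times |h|. *)
Let taylor w h : normc (w - c) < r / 2 -> normc (w + h - c) < r / 2 ->
  normc (G (w + h) - G w - G' w * h) <= 4 * M / r * normc h ^+ 2.
Proof.
move=> wr whr; have r0 : 0 < r by have := normc_ge0 (w - c); lra.
have cr : normc (w - c) < r by lra.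
have L0 : 0 <= 4 * M / r by rewrite divr_ge0 ?mulr_ge0 ?(M_ge0 cr)// ltW.
have := @cdiff_mean_value R (fun x => G x - G' w * x) (fun x => G' x - (G' w * 1 + 0 * x))
   (w + h) w (4 * M / r * normc h).
rewrite (addrC w h) addrK (addrC h w) expr2 mulrA => H.
have -> : G (w + h) - G w - G' w * h = G (w + h) - G' w * (w + h) - (G w - G' w * w).
  by ring.
apply: H => t t01.
have sr : normc (w + (t%:C)%C * h - c) < r / 2.
  by have := segment_in_disc whr wr t01; rewrite (addrC w h) addrK.
split.
  apply: cdiffB; first by apply: (HG _).1; lra.
  by apply: (@cdiffM R (fun=> G' w) id); [exact: cdiff_cst|exact: cdiff_id].
rewrite mulr1 mul0r addr0; apply: le_trans (cdiff_deriv_lipschitz sr wr) _.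
rewrite (addrC w) addrK ler_wpM2l// Normc.normcM normc_real.
by have /andP[t0 t1] := t01; rewrite ger0_norm// ler_piMl// normc_ge0.
Qed.

Let cont_cexp s : continuous (fun t : R => cexp (Complex s t) : C).
Proof.
move=> t; apply/cvgCP => e e0.
have [d d0 Hd] := cdiff_bound (cdiff_cexp (Complex s t)).
have := normc_ge0 (cexp (Complex s t)); set n := normc _ in Hd * => n0.
clearbody n; apply/nbhs_normP; exists (Num.min d (e / (1 + n))).
  by rewrite /= lt_min d0 divr_gt0//; lra.
move=> y yt; have : `|t - y| < Num.min d (e / (1 + n)) by exact: yt.
rewrite lt_min ltr_pdivlMr; last by lra.
move=> /andP[yd ye].
have E : Complex s y = Complex s t + Complex 0 (y - t) :> R[i].
  by apply/eqP; rewrite eq_complex /=; apply/andP; split; apply/eqP; ring.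
have nE : normc (Complex 0 (y - t)) = `|t - y|.
  by rewrite /= expr0n /= add0r sqrtr_sqr distrC.
rewrite -normcN opprB E; apply: le_lt_trans (Hd _ _) _; rewrite nE//.
by rewrite mulrC.
Qed.

Let cont_re (u : R -> C) : continuous u -> continuous (fun t => re (u t)).
Proof.
move=> cu t; apply/cvgrPdist_lt => e e0.
have /cvgCP/(_ e e0) := cu t; apply: filterS => y.
by rewrite -ReB; apply: le_lt_trans; exact: normc_Re.
Qed.

Let cont_im (u : R -> C) : continuous u -> continuous (fun t => im (u t)).
Proof.
move=> cu t; apply/cvgrPdist_lt => e e0.
have /cvgCP/(_ e e0) := cu t; apply: filterS => y.
by rewrite -ImB; apply: le_lt_trans; exact: normc_Im.
Qed.

Let cont_deriv s : expR s < r / 2 -> continuous (fun t : R => G' (c + cexp (Complex s t)) : C).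
Proof.
move=> sr t; have r0 : 0 < r by have := expR_gt0 s; lra.
have cr : normc (c - c) < r by rewrite subrr Normc.normc0.
have M0 := M_ge0 cr.
have p0 : 0 < 1 + 4 * M / r by rewrite ltr_pwDl// divr_ge0 ?mulr_ge0// ltW.
apply/cvgCP => e e0.
have /cvgCP/(_ (e / (1 + 4 * M / r)) (divr_gt0 e0 p0)) := @cont_cexp s t.
apply: filterS => y; rewrite ltr_pdivlMr// => ye.
have inr (v : R) : normc (c + cexp (Complex s v) - c) < r / 2.
  by rewrite addrAC subrr add0r normc_cexp.
apply: le_lt_trans (cdiff_deriv_lipschitz (inr t) (inr y)) _.
rewrite (_ : c + cexp (Complex s t) - (c + cexp (Complex s y)) =
  cexp (Complex s t) - cexp (Complex s y)); last by ring.
apply: le_lt_trans ye; rewrite mulrC ler_wpM2l ?normc_ge0//; lra.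
Qed.

(** The candidate l is the mean of [L], the z-derivative of the quotient at z = c. The error G'(c +
    h) - G' c - l h is then a mean of differences of two second-order remainders of G, each O(|h|^2)
    by [taylor]. *)
Lemma cdiff_deriv : 0 < r -> exists l, cdiff G' c l.
Proof.
(* On the circle of radius r / 4 the points c + e^u + h with |h| < r / 4 stay in the disc of radius
   r / 2, where [taylor] holds. *)
move=> r0; pose s := ln (r / 4).
have es : expR s = r / 4 by rewrite lnK// posrE; lra.
pose L (t : R) : C := (G' (c + cexp (Complex s t)) - G' c) * cexp (- Complex s t).
have cL : continuous L.
  move=> t; apply: (@cvgM R[i] R (nbhs t) _ (fun t => G' (c + cexp (Complex s t)) - G' c)
    (fun t => cexp (- Complex s t))).
    apply: (@cvgB R[i] C R (nbhs t) _ (fun t => G' (c + cexp (Complex s t))) (fun=> G' c)).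
      by apply: cont_deriv; rewrite es; lra.
    exact: cvg_cst.
  rewrite (_ : (fun t => cexp (- Complex s t)) = (fun t => cexp (Complex (- s) t)) \o -%R) //.
  apply: (@continuous_comp _ _ _ (-%R : R -> R) (fun t => cexp (Complex (- s) t) : C)).
    exact: oppr_continuous.
  exact: cont_cexp.
have cRe k : continuous (fun t => re (k * L t)).
  apply: cont_re => t; apply: (@cvgM R[i] R (nbhs t) _ (fun=> k) L); last exact: cL.
  exact: cvg_cst.
pose l := (T^-1%:C)%C * Complex (circ (fun t => re (L t))) (circ (fun t => im (L t))).
have lE k : re (k * l) * T = circ (fun t => re (k * L t)).
  have -> : (fun t => re (k * L t)) = (fun t => re k * re (L t) - im k * im (L t)).
    by apply/funext => t; case: k (L t) => [a b] [a' b'].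
  have cr := cont_re cL; have ci := cont_im cL.
  rewrite circB; last 2 first.
  - by move=> t; apply: (@continuousM R R (fun=> re k) (fun t => re (L t))); [exact: cst_continuous|exact: cr].
  - by move=> t; apply: (@continuousM R R (fun=> im k) (fun t => im (L t))); [exact: cst_continuous|exact: ci].
  rewrite !circZ// /l mulrCA Re_real_mul mulrAC mulVf ?gt_eqF ?T_gt0// mul1r.
  by case: k.
exists l => e e0.
have c0 : normc (c - c) = 0 by rewrite subrr Normc.normc0.
have M0 : 0 <= M by apply: (@M_ge0 c); rewrite c0.
pose Lam := 4 * M / r; have Lam0 : 0 <= Lam by rewrite divr_ge0 ?mulr_ge0// ltW.
(* Two remainders with constant [Lam], divided by the radius of the circle. *)
pose K := 2 * Lam / (r / 4); have r4 : 0 < r / 4 by lra.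
have K0 : 0 <= K by rewrite divr_ge0 ?(ltW r4)// mulr_ge0.
exists (Num.min (r / 4) (e / (1 + K))).
  by rewrite lt_min r4 divr_gt0// ltr_pwDl.
have K1 : 0 < 1 + K by rewrite ltr_pwDl.
move=> h; rewrite lt_min (ltr_pdivlMr _ _ K1).
move=> /andP[hr he]; have h0 := normc_ge0 h.
have hc : normc (c + h - c) = normc h by rewrite addrAC subrr add0r.
have cs : normc (c - c) + expR s < r by rewrite c0 es; lra.
have hs : normc (c + h - c) + expR s < r by rewrite hc es; lra.
have [k [k1 <-]] := normc_dual (G' (c + h) - G' c - l * h).
apply: (@le_trans _ _ (K * normc h ^+ 2)); last first.
  rewrite expr2 mulrA ler_wpM2r// (le_trans _ (ltW he))// mulrDr mulr1 mulrC.
  by rewrite lerDr.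
rewrite -(ler_pM2r (T_gt0 R)) !mulrBr !ReB !mulrBl (mulrC l) mulrA lE.
rewrite -(circ_quot _ hs) -(circ_quot _ cs).
have c1 := @cont_quot (c + h) k s hs; have c2 := @cont_quot c k s cs.
have c3 := cRe (k * h).
have c12 : continuous (fun t => re (k * cquot (c + h) (Complex s t)) -
    re (k * cquot c (Complex s t))).
  exact: continuous_subr.
rewrite -circB// -circB//; apply: le_trans (ler_norm _) _; apply: circ_bound.
  exact: continuous_subr.
move=> t; set u := Complex s t.
have -> : re (k * cquot (c + h) u) - re (k * cquot c u) - re (k * h * L t) =
   re (k * (((G (c + cexp u + h) - G (c + cexp u) - G' (c + cexp u) * h) -
            (G (c + h) - G c - G' c * h)) * cexp (- u))).
  by rewrite -!ReB /cquot /L -/u (addrAC c h); congr re; ring.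
have uc : normc (c + cexp u - c) = r / 4.
  by rewrite addrAC subrr add0r normc_cexp.
have uh : normc (c + cexp u + h - c) < r / 2.
  have -> : c + cexp u + h - c = (c + cexp u - c) + h by ring.
  by apply: le_lt_trans (le_normcD _ _) _; rewrite uc; lra.
apply: le_trans (Re_mul_le k (M := K * normc h ^+ 2) _) _; last first.
  by rewrite ler_piMl// mulr_ge0// sqr_ge0.
rewrite Normc.normcM normc_cexp.
have -> : re (- u) = - s by [].
rewrite expRN es -ler_pdivlMr ?invr_gt0; last by lra.
have -> : K * normc h ^+ 2 / (r / 4)^-1 = Lam * normc h ^+ 2 + Lam * normc h ^+ 2.
  by rewrite /K; field; lra.
apply: le_trans (normc_sub_le _ _) _; apply: lerD.
  by apply: taylor; rewrite ?uc//; lra.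
by apply: taylor; rewrite ?hc ?c0//; lra.
Qed.

End Regularity.

(** * Holomorphic functions on sectors *)

Section SectorClass.
Variable R : realType.
Local Notation C := (R[i]^o).
Local Notation normc := Normc.normc.
Local Notation re := complex.Re.
Local Notation im := complex.Im.
Implicit Types (f g : R * R -> C) (z y : R * R) (u h k l m : R[i]) (e d : R).

Lemma nbhs_prodP z (P : set (R * R)) : nbhs z P <-> exists2 e, 0 < e &
  forall y, `|z.1 - y.1| < e -> `|z.2 - y.2| < e -> P y.
Proof.
split=> [/nbhs_ballP[e /= e0 H]|[e e0 H]].
  exists e => // y y1 y2; apply: H; split.
    by rewrite -ball_normE.
  by rewrite -ball_normE.
apply/nbhs_ballP; exists e => // y [].
by rewrite -!ball_normE; exact: H.
Qed.

(** Properness makes limits of difference quotients unique, so that [cderive] can be computed from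
    any limit that is found. *)
#[local] Instance dnbhs_prod_proper z : ProperFilter z^'.
Proof.
apply: Build_ProperFilter => /nbhs_prodP[e e0 /(_ (z.1 + e / 2, z.2))] /=.
rewrite opprD addNKr normrN subrr normr0 gtr0_norm ?divr_gt0// ltr_pdivrMr// ltr_pMr// ltr1n.
move=> /(_ isT e0); apply; apply/eqP => /(congr1 fst) /= /eqP.
by rewrite -subr_eq0 addrAC subrr add0r gt_eqF// divr_gt0.
Qed.

Definition pexp u : R * R := (expR (re u), im u).

Definition plog z : R[i] := Complex (ln z.1) z.2.

Lemma log_proj_pexp u : log_proj (pexp u) = cexp u.
Proof. by []. Qed.

Lemma plogK z : 0 < z.1 -> pexp (plog z) = z.
Proof. by case: z => a b /= a0; rewrite /pexp /plog /= lnK. Qed.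

Lemma pexpK u : plog (pexp u) = u.
Proof. by case: u => a b; rewrite /plog /pexp /= expRK. Qed.

(** The chart and its inverse are continuous, so punctured neighbourhoods correspond. The bound by
    [expR (re u)] keeps the first coordinate positive, where [plog] inverts [pexp]. *)
Lemma dnbhs_pexp u (P : set (R * R)) : (\forall y \near (pexp u)^', P y) <->
  exists2 d, 0 < d & forall h, h != 0 -> normc h < d -> P (pexp (u + h)).
Proof.
split=> [/nbhs_prodP[e e0 H]|[d d0 H]].
  have /cvgrPdist_lt/(_ e e0)/nbhs_normP[d /= d0 Hd] := @continuous_expR R (re u).
  exists (Num.min d e); first by rewrite lt_min d0.
  move=> h h0; rewrite lt_min => /andP[hd he].
  have uh : u != u + h by apply: contra h0 => /eqP E; rewrite -(addKr u h) -E addNr.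
  apply: H; rewrite /pexp /=.
  - apply: Hd; rewrite /= ReD opprD addNKr normrN.
    exact: le_lt_trans (normc_Re h) hd.
  - have -> : im u - im (u + h) = - im h by case: (u) (h) => [? ?] [? ?] /=; ring.
    by rewrite normrN; exact: le_lt_trans (normc_Im h) he.
  - apply: contra uh => /eqP E; apply/eqP; rewrite -[LHS]pexpK -[RHS]pexpK.
    by congr plog; exact/esym.
have z0 : 0 < expR (re u) by exact: expR_gt0.
have /cvgrPdist_lt/(_ (d / 2) (divr_gt0 d0 (ltr0n _ 2)))/nbhs_normP[e /= e0 He] :=
  continuous_ln z0.
apply/nbhs_prodP; exists (Num.min (Num.min e (expR (re u))) (d / 2)).
  by rewrite !lt_min e0 z0 divr_gt0.
move=> y; rewrite !lt_min => /andP[/andP[ye yu] _] /andP[_ yd] yneq.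
have y0 : 0 < y.1 by move: yu; rewrite /= ltr_distl => /andP[]; lra.
have yE : pexp (u + (plog y - u)) = y by rewrite addrC subrK plogK.
rewrite -yE; apply: H.
  by apply: contra yneq; rewrite subr_eq0 => /eqP E; rewrite -E plogK.
apply: le_lt_trans (normc_le_ReIm _) _; rewrite ReB ImB.
have := He y.1 ye; rewrite expRK /= => H1; move: yd => /= H2.
by rewrite (distrC (ln _)) (distrC y.2); lra.
Qed.

(** Once the linearization error is at most half of |e^u| |h|, the increment of the exponential is
    comparable with |e^u| |h|, up to a factor 2 either way. *)
Lemma cexpB_bounds u : exists2 d, 0 < d & forall e, 0 < e -> exists2 d', 0 < d' &
  forall h, normc h < d -> normc h < d' ->
  [/\ normc (cexp (u + h) - cexp u - cexp u * h) <= e * normc h,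
      normc (cexp u) * normc h <= 2 * normc (cexp (u + h) - cexp u) &
      normc (cexp (u + h) - cexp u) <= 2 * normc (cexp u) * normc h].
Proof.
have g0 : 0 < normc (cexp u) by rewrite normc_cexp expR_gt0.
have [d d0 Hd] := cdiff_cexp u (divr_gt0 g0 (ltr0n R 2)).
exists d => // e e0; have [d' d'0 Hd'] := cdiff_cexp u e0.
exists d' => // h hd hd'; split; first exact: Hd'.
  have := Hd h hd; set k := _ - cexp u => H.
  have := normc_sub_le k (k - cexp u * h); rewrite opprB addrC subrK Normc.normcM.
  by have := normc_ge0 h; lra.
have := Hd h hd; set k := _ - cexp u => H.
have := le_normcD (k - cexp u * h) (cexp u * h); rewrite subrK Normc.normcM.
by have := normc_ge0 h; nra.
Qed.

(* [plog] is a global chart of the Riemann surface of the logarithm. *)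
Lemma diff_quot_cdiff f u l : diff_quot f (pexp u) @ (pexp u)^' --> (l : C) ->
  cdiff (fun u => f (pexp u)) u (l * cexp u).
Proof.
move=> /cvgCP H e e0.
have g0 : 0 < normc (cexp u) by rewrite normc_cexp expR_gt0.
have nl := normc_ge0 l.
have [d d0 Hd] := cexpB_bounds u.
have e10 : 0 < e / (2 * (1 + normc l)) by rewrite divr_gt0// mulr_gt0//; lra.
have [d1 d10 Hd1] := Hd _ e10.
have e20 : 0 < e / (4 * normc (cexp u)) by rewrite divr_gt0// mulr_gt0.
have /dnbhs_pexp[d2 d20 Hd2] := H _ e20.
exists (Num.min d (Num.min d1 d2)); first by rewrite !lt_min d0 d10.
move=> h; rewrite !lt_min => /and3P[hd hd1 hd2].
have [->|h0] := eqVneq h 0; first by rewrite addr0 subrr mulr0 subrr Normc.normc0 mulr0.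
have nh : 0 < normc h by rewrite normc_gt0.
have [B1 B2 B3] := Hd1 h hd hd1; have := Hd2 h h0 hd2.
rewrite /diff_quot !log_proj_pexp; set k := cexp (u + h) - cexp u in B1 B2 B3 *.
have k0 : k != 0 by rewrite -normc_gt0; have := mulr_gt0 g0 nh; lra.
set D : R[i] := f (pexp (u + h)) - f (pexp u) => B4.
have -> : D - l * cexp u * h = - ((l - D / k) * k) + l * (k - cexp u * h).
  by rewrite mulrBl divfK//; ring.
apply: le_trans (le_normcD _ _) _; rewrite normcN !Normc.normcM.
have -> : e * normc h = e / (4 * normc (cexp u)) * (2 * normc (cexp u) * normc h) + e / 2 * normc h.
  by field; lra.
apply: lerD; first by apply: ler_pM => //; rewrite ?normc_ge0// ltW.
apply: le_trans (ler_wpM2l nl B1) _.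
have -> : normc l * (e / (2 * (1 + normc l)) * normc h) =
   (e / 2 * normc h) * (normc l / (1 + normc l)) by field; lra.
rewrite ler_piMr ?mulr_ge0// ?(ltW e0)// ?(ltW nh)//.
by rewrite ler_pdivrMr; lra.
Qed.

Lemma cdiff_diff_quot f u m : cdiff (fun u => f (pexp u)) u m ->
  diff_quot f (pexp u) @ (pexp u)^' --> (m / cexp u : C).
Proof.
move=> H; apply/cvgCP => e e0; apply/dnbhs_pexp.
have g0 : 0 < normc (cexp u) by rewrite normc_cexp expR_gt0.
set g := normc (cexp u) in g0.
have nm := normc_ge0 m.
have [d d0 Hd] := cexpB_bounds u.
have e10 : 0 < e * g ^+ 2 / (8 * (1 + normc m)).
  by rewrite divr_gt0// mulr_gt0// ?exprn_gt0//; lra.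
have [d1 d10 Hd1] := Hd _ e10.
have e20 : 0 < e * g / 8 by rewrite divr_gt0// mulr_gt0.
have [d2 d20 Hd2] := H _ e20.
exists (Num.min d (Num.min d1 d2)); first by rewrite !lt_min d0 d10.
move=> h h0; rewrite !lt_min => /and3P[hd hd1 hd2].
have nh : 0 < normc h by rewrite normc_gt0.
have [B1 B2 _] := Hd1 h hd hd1; have B3 := Hd2 h hd2.
rewrite /diff_quot !log_proj_pexp; set k := cexp (u + h) - cexp u in B1 B2 *.
rewrite -/g in B2.
have nk : 0 < normc k by have := mulr_gt0 g0 nh; lra.
have k0 : k != 0 by rewrite -normc_gt0.
set D : R[i] := f (pexp (u + h)) - f (pexp u) in B3 *.
have -> : m / cexp u - D / k = (m * (k - cexp u * h) - cexp u * (D - m * h)) / (cexp u * k).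
  by field; rewrite k0 cexp_neq0.
rewrite Normc.normcM Normc.normcV Normc.normcM -/g ltr_pdivrMr ?mulr_gt0//.
apply: (@le_lt_trans _ _ (e * g ^+ 2 / 4 * normc h)).
  apply: le_trans (normc_sub_le _ _) _; rewrite !Normc.normcM -/g.
  have -> : e * g ^+ 2 / 4 * normc h = e * g ^+ 2 / 8 * normc h + g * (e * g / 8 * normc h) by field.
  apply: lerD; last by rewrite ler_pM2l.
  apply: le_trans (ler_wpM2l nm B1) _.
  have -> : normc m * (e * g ^+ 2 / (8 * (1 + normc m)) * normc h) =
    (e * g ^+ 2 / 8 * normc h) * (normc m / (1 + normc m)) by field; lra.
  rewrite ler_piMr ?mulr_ge0// ?(ltW e0)// ?(ltW nh)// ?exprn_ge0 ?(ltW g0)//.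
  by rewrite ler_pdivrMr; lra.
have eg : 0 < e * g by rewrite mulr_gt0.
have -> : e * g ^+ 2 / 4 * normc h = e * g * (g * normc h / 4) by field.
rewrite (mulrA e g (normc k)) ltr_pM2l//; have := mulr_gt0 g0 nh; lra.
Qed.

Variables t0 t1 : R.
Local Notation S := (@sector R t0 t1).

Lemma near_sector z : S z -> \forall y \near z^', S y.
Proof.
case: z => a b [/= a0 /andP[b0 b1]]; apply/nbhs_prodP.
exists (Num.min a (Num.min (b - t0) (t1 - b))); first by rewrite !lt_min a0 !subr_gt0 b0.
move=> [x y] /=; rewrite !lt_min => /and3P[+ _ _] /and3P[_ + +] _.
rewrite /sector /= !ltr_distl => /andP[H1 H2] /andP[H3 H4] /andP[H5 H6].
by split; [lra|apply/andP; split; lra].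
Qed.

(** In the chart, f becomes v -> f(pexp v) with derivative f'(pexp v) e^v, which is bounded on discs
    inside the strip t0 < Im v < t1. [cdiff_deriv] differentiates this derivative, and dividing by
    e^v returns to f'. The radius r is the distance from u to the edges of the strip. *)
Lemma holomorphic_cderive f (M : R) : holomorphic_on S f ->
  (forall z, S z -> normc (cderive f z) <= M) -> holomorphic_on S (cderive f).
Proof.
move=> hf fM z Sz; have [z0 /andP[zt0 zt1]] := Sz.
rewrite -(plogK z0); set u := plog z.
pose F' (v : C) : C := cderive f (pexp v) * cexp v.
pose r := Num.min (z.2 - t0) (t1 - z.2).
have r0 : 0 < r by rewrite lt_min !subr_gt0 zt0.
have [l dF'] : exists l, cdiff F' u l.
  apply: (@cdiff_deriv R (fun v => f (pexp v)) F' u r (`|M| * expR (re u + r))) => // v vr.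
  have Sv : S (pexp v).
    split; first exact: expR_gt0.
    have := le_lt_trans (normc_Im _) vr; rewrite ImB /= lt_min ltr_distl ltr_norml.
    move=> /andP[/andP[H1 _] /andP[_ H2]].
    by apply/andP; split; lra.
  split; first by apply: diff_quot_cdiff; exact: hf.
  rewrite Normc.normcM normc_cexp; apply: ler_pM; rewrite ?normc_ge0 ?expR_ge0//.
    by rewrite (le_trans (fM _ Sv))// ler_norm.
  rewrite ler_expR; have := le_lt_trans (normc_Re _) vr.
  by rewrite ReB ltr_distl => /andP[_]; exact: ltW.
apply: cvgP; apply: cdiff_diff_quot.
have -> : (fun v : C => cderive f (pexp v)) = (fun v => F' v * cexp (- v)).
  by apply/funext => v; rewrite /F' -mulrA -cexpD subrr cexp0 mulr1.
apply: cdiffM; first exact: dF'.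
apply: (@cdiff_comp R (fun v => - v) (@cexp R)); last exact: cdiff_cexp.
rewrite (_ : (fun v => - v) = (fun v : C => 0 - v)); last by apply/funext => v; rewrite sub0r.
by apply: cdiffB; [exact: cdiff_cst|exact: cdiff_id].
Qed.

Lemma holomorphic_iter f p : holomorphic_on S f ->
    (forall p, exists M : R, forall z, S z -> normc (iter p (@cderive R) f z) <= M) ->
  holomorphic_on S (iter p (@cderive R) f).
Proof.
move=> hf bf; elim: p => [//|p IH].
by have [M HM] := bf p.+1; apply: holomorphic_cderive HM.
Qed.

(** A difference of limits is the limit of the difference only if both quotients converge, hence the
    assumption on all iterates. The identity is used near z, as the quotient involves nearby
    points. *)
Lemma iter_cderiveB f g p z :
    (forall p, holomorphic_on S (iter p (@cderive R) f)) ->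
    (forall p, holomorphic_on S (iter p (@cderive R) g)) -> S z ->
  iter p (@cderive R) (g - f) z = iter p (@cderive R) g z - iter p (@cderive R) f z.
Proof.
move=> hf hg; elim: p z => [//|p IH] z Sz.
have cf := hf p z Sz; have cg := hg p z Sz; rewrite !iterS.
set h := iter p _ (g - f) in IH *.
apply: (@cvg_lim C); first exact: norm_hausdorff.
apply: cvg_trans (cvgB cg cf); apply: near_eq_cvg.
have := near_sector Sz; apply: filterS => y Sy.
by rewrite /diff_quot !IH// !fctE -mulrBl; congr (_ / _); ring.
Qed.

Lemma norm_AE a f :
  ereal_sup [set (normc (iter p (@cderive R) f z) / a p)%:E | z in S & p in [set: nat]] =
  ereal_sup [set (normc (iter v.2 (@cderive R) f v.1) / a v.2)%:E | v in S `*` [set: nat]].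
Proof.
congr ereal_sup; apply/seteqP; split=> y.
  by move=> [x Kx [b _ <-]]; exists (x, b).
by move=> [[x b] [/= Kx _] <-]; exists x => //; exists b.
Qed.

Lemma sup_normed_A : sup_normed (class_A t0 t1).
Proof.
move=> []; exists ((R * R) * nat)%type, (S `*` setT).
exists (fun f (v : (R * R) * nat) => normc (iter v.2 (@cderive R) f v.1)), snd.
by split=> [f v|a f]; [exact: normc_ge0|exact: norm_AE].
Qed.

(** Finiteness of the norm bounds every iterated [cderive], which by [holomorphic_iter] makes all
    iterates holomorphic; only then is the iterated derivative of g - f a difference. *)
Lemma norm_sub_closed_A : norm_sub_closed (class_A t0 t1).
Proof.
move=> A f g _ A0 Af Ag [] a Aa.
have [[hf _]] := Af tt a Aa; have [[hg _]] := Ag tt a Aa.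
rewrite [fc_norm _ _ _]norm_AE => Ng; rewrite [fc_norm _ _ _]norm_AE => Nf.
rewrite [fc_norm _ _ _]norm_AE.
have bounded (h : R * R -> C) : (ereal_sup [set (normc (iter v.2 (@cderive R) h v.1) / a v.2)%:E |
      v in S `*` [set: nat]] < +oo)%E ->
    forall p, exists M : R, forall z, S z -> normc (iter p (@cderive R) h z) <= M.
  move=> /ereal_sup_ltyP[M HM] p; exists (M * a p) => z Sz.
  by have := HM (z, p) (conj Sz Logic.I); rewrite /= ler_pdivrMr// A0.
have itf p := @holomorphic_iter f p hf (bounded _ Nf).
have itg p := @holomorphic_iter g p hg (bounded _ Ng).
apply: ereal_sup_sub_lty Ng Nf => -[z p] [/= Sz _].
rewrite iter_cderiveB// -mulrDl ler_wpM2r ?normc_sub_le//.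
by rewrite invr_ge0 ltW// A0.
Qed.

End SectorClass.

(** * Products of weight matrices *)

Lemma weighted_class_norms (R : realType) (F : fclass R) : weighted_class F ->
  sup_normed F /\ norm_sub_closed F.
Proof.
case=> [d U _ oU _|d U _ oU _|t0 t1 _|||]; split.
- exact: sup_normed_E.
- exact: norm_sub_closed_E.
- exact: sup_normed_B.
- exact: norm_sub_closed_B.
- exact: sup_normed_A.
- exact: norm_sub_closed_A.
- exact: sup_normed_S.
- exact: norm_sub_closed_S.
- exact: sup_normed_Lambda.
- exact: norm_sub_closed_Lambda.
(* A formal power series is its coefficient sequence with the same norm, so the two classes are
   convertible. *)
- exact: sup_normed_Lambda.
- exact: norm_sub_closed_Lambda.
Qed.

(** * Cofinal families of weight sequences *)

Section Cofinality.
Variable R : realType.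
Implicit Types (w v : R -> R) (a b : nat -> R) (A B : set (nat -> R)) (M N : R -> nat -> R).
Implicit Types (c l j : R).

(** The first clause (a larger weight in B) serves the Roumieu case, the second (a smaller one) the
    Beurling case. *)
Definition cofinal A B := (forall a, A a -> exists2 b, B b & dominated a b) /\
  (forall a, A a -> exists2 b, B b & dominated b a).

Lemma fspace_eq (F : fclass R) k A B : weighted_class F ->
  (forall a, A a -> posw a) -> (forall b, B b -> posw b) ->
  cofinal A B -> cofinal B A -> fspace F k A = fspace F k B.
Proof.
move=> /weighted_class_norms[sF bF] A0 B0 [AB AB'] [BA BA'].
by case: k; [apply: fspace_Roumieu_eq|apply: fspace_Beurling_eq].
Qed.

Lemma posw_omega_weights w a : omega_weights w a -> posw a.
Proof. by move=> [l _ <-] p; exact: wmatrix_gt0. Qed.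

Lemma posw_mat_weights M a : (forall l p, 0 < M l p) -> mat_weights M a -> posw a.
Proof. by move=> M0 [l [h [l0 h0 ->]]] p; rewrite mulr_gt0// exprn_gt0. Qed.

Lemma cofinal_omega_weights w v c D c' D' : zero01 w -> zero01 v -> superlog w ->
    superlog v -> 0 < c -> 0 < c' -> (forall t, 0 <= t -> w t <= c * v t + D) ->
    (forall t, 0 <= t -> v t <= c' * w t + D') ->
  cofinal (omega_weights w) (omega_weights v).
Proof.
move=> w0 v0 sw sv c0 c'0 wv vw; split=> _ [l /= l0 <-].
  have lc : 0 < l * c' by rewrite mulr_gt0.
  exists (wmatrix v (l * c')); first by exists (l * c').
  exists (expR (D' / (l * c'))); first exact: expR_gt0.
  by move=> p; have := wmatrix_compare p w0 v0 sv c'0 lc vw; rewrite mulfK ?gt_eqF.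
exists (wmatrix v (l / c)); first by exists (l / c) => //=; rewrite divr_gt0.
exists (expR (D / l)); first exact: expR_gt0.
by move=> p; exact: wmatrix_compare.
Qed.

(** The factor h^p is harmless in [mat_weights], which contains all its multiples, and bounded after
    taking p-th roots in [seq_preceq]. *)
Definition geom_dominated a b := exists C h, [/\ 1 <= C, 1 <= h &
  forall p, a p <= C * h ^+ p * b p].

Lemma cofinal_mat_weights M N : (forall l, 0 < l -> geom_dominated (M l) (N l)) ->
  (forall l, 0 < l -> geom_dominated (N l) (M l)) ->
  cofinal (mat_weights M) (mat_weights N).
Proof.
move=> MN NM; split=> _ [l [h [l0 h0 ->]]].
  have [C [g [C1 g1 Hg]]] := MN l l0.
  have C0 : 0 < C by rewrite (lt_le_trans _ C1).
  have g0 : 0 < g by rewrite (lt_le_trans _ g1).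
  exists (fun p => (h * g) ^+ p * N l p); first by exists l, (h * g); rewrite mulr_gt0.
  exists C => // p; rewrite exprMn.
  have -> : C * (h ^+ p * g ^+ p * N l p) = h ^+ p * (C * g ^+ p * N l p) by ring.
  by rewrite ler_pM2l ?exprn_gt0.
have [C [g [C1 g1 Hg]]] := NM l l0.
have C0 : 0 < C by rewrite (lt_le_trans _ C1).
have g0 : 0 < g by rewrite (lt_le_trans _ g1).
exists (fun p => (h / g) ^+ p * N l p); first by exists l, (h / g); rewrite divr_gt0.
exists C => // p; rewrite exprMn exprVn.
rewrite mulrAC ler_pdivrMr ?exprn_gt0//.
have -> : C * (h ^+ p * M l p) * g ^+ p = h ^+ p * (C * g ^+ p * M l p) by ring.
by rewrite ler_pM2l ?exprn_gt0.
Qed.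

(** For p >= 1 and C >= 1 the p-th root of C h^p is at most C h. *)
Lemma seq_preceq_geom a b : posw a -> posw b -> geom_dominated a b -> seq_preceq a b.
Proof.
move=> a0 b0 [C [h [C1 h1 H]]]; apply: le_lt_trans (ltry (C * h)).
apply: ge_ereal_sup => _ [p /= p1 <-]; rewrite lee_fin.
have C0 : 0 <= C by rewrite (le_trans _ C1).
have h0 : 0 <= h by rewrite (le_trans _ h1).
have pp : p%:R != 0 :> R by rewrite pnatr_eq0 -lt0n.
apply: (@le_trans _ _ ((C * h ^+ p) `^ p%:R^-1)).
  have ab0 : 0 <= a p / b p by rewrite divr_ge0// ltW.
  apply: ge0_ler_powR; rewrite ?invr_ge0// ?nnegrE ?ler_pdivrMr//.
  by rewrite mulr_ge0// exprn_ge0.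
rewrite powRM ?exprn_ge0// -powR_mulrn// -powRrM mulfV// powRr1// ler_wpM2r//.
rewrite -[leRHS]powRr1//; apply: ler_powR => //.
by rewrite invf_le1 ?ler1n// ltr0n.
Qed.

Lemma mapprox_geom k M N : (forall l p, 0 < M l p) -> (forall l p, 0 < N l p) ->
  (forall l, 0 < l -> geom_dominated (M l) (N l)) ->
  (forall l, 0 < l -> geom_dominated (N l) (M l)) -> mapprox k M N.
Proof.
move=> M0 N0 MN NM.
by case: k; split=> l l0; exists l => //; apply: seq_preceq_geom; auto; exact: M0 || exact: N0.
Qed.

End Cofinality.

(** * The two weights and their product matrix *)

Section Pairs.
Variables (R : realType) (sigma tau : R -> R).
Hypotheses (ws : W0 sigma) (wt : W0 tau).
Implicit Types (l j : R).
Local Notation S := (wmatrix sigma).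
Local Notation T := (wmatrix tau).
Local Notation L := (legendre sigma tau).
Local Notation Q l j := (legendre (omega_of (S l)) (omega_of (T j))).
Local Notation O l j := (omega_of (S l \* T j)).

Hint Resolve W0_nneg W0_zero01 W0_superlog : core.

Lemma omega_wmatrix_nneg w l : W0 w -> 0 < l -> nneg_fun (omega_of (wmatrix w l)).
Proof.
move=> ww l0 t t0; rewrite wmatrixE; apply: omega_nneg => //.
  by apply: log_wmatrix_tempered; auto.
by apply: log_wmatrix_0; auto.
Qed.

Lemma omega_mulE l j t : 0 < l -> 0 < j -> 0 <= t -> O l j t = Q l j t.
Proof.
move=> l0 j0 t0; rewrite !wmatrixE; apply: omega_of_mul => //.
- by apply: log_wmatrix_tempered; auto.
- by apply: log_wmatrix_tempered; auto.
- by apply: log_wmatrix_convex; auto.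
- by apply: log_wmatrix_convex; auto.
- by apply: log_wmatrix_0; auto.
- by apply: log_wmatrix_0; auto.
- by move=> p; apply: log_wmatrix_ge0; auto.
- by move=> p; apply: log_wmatrix_ge0; auto.
Qed.

(** The bounds sigma / l and tau / j on the associated weight functions, with both factors enlarged
    to their sum. The summand 0 keeps the shape c w + D of the comparison lemmas. *)
Lemma Q_le_L l j t : 0 < l -> 0 < j -> 0 <= t -> Q l j t <= (l^-1 + j^-1) * L t + 0.
Proof.
move=> l0 j0 t0; rewrite addr0.
have il : 0 < l^-1 by rewrite invr_gt0.
have ij : 0 < j^-1 by rewrite invr_gt0.
have c0 : 0 < l^-1 + j^-1 by rewrite addr_gt0.
rewrite -ler_pdivrMl//; apply: le_legendre => s s0; rewrite ler_pdivrMl//.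
have nS := omega_wmatrix_nneg ws l0; have nT := omega_wmatrix_nneg wt j0.
apply: le_trans (legendre_le nS nT s0 t0) _.
have ts0 : 0 <= t / s by rewrite divr_ge0// ltW.
have := omega_wmatrix_le (W0_zero01 ws) (W0_superlog ws) (W0_nneg ws) l0 (ltW s0).
have := omega_wmatrix_le (W0_zero01 wt) (W0_superlog wt) (W0_nneg wt) j0 ts0.
have := W0_nneg ws (ltW s0); have := W0_nneg wt ts0.
have arith (a b x y o p : R) : 0 <= a -> 0 <= b -> 0 <= y -> 0 <= x ->
    p <= b * y -> o <= a * x -> o + p <= (a + b) * (x + y) by nra.
exact: arith (ltW il) (ltW ij).
Qed.

Lemma L_le_Q l j : 0 < l -> 0 < j ->
  exists D, forall t, 0 <= t -> L t <= 2 * (l + j) * Q l j t + D.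
Proof.
move=> l0 j0; have [D1 H1] := W0_le_omega ws l0; have [D2 H2] := W0_le_omega wt j0.
exists (D1 + D2) => t t0.
have c0 : 0 < 2 * (l + j) by rewrite mulr_gt0// addr_gt0.
rewrite -lerBlDr -ler_pdivrMl//; apply: le_legendre => s s0; rewrite ler_pdivrMl//.
have ts0 : 0 <= t / s by rewrite divr_ge0// ltW.
have := legendre_le (W0_nneg ws) (W0_nneg wt) s0 t0.
have := H1 s (ltW s0); have := H2 _ ts0.
have := omega_wmatrix_nneg ws l0 (ltW s0); have := omega_wmatrix_nneg wt j0 ts0.
have arith (x y o p z : R) : 0 <= p -> 0 <= o -> y <= 2 * j * p + D2 ->
    x <= 2 * l * o + D1 -> z <= x + y -> z - (D1 + D2) <= 2 * (l + j) * (o + p) by nra.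
exact: arith.
Qed.

Lemma superlog_compare w v (c D : R) : superlog v -> 0 < c ->
  (forall t, 0 <= t -> v t <= c * w t + D) -> superlog w.
Proof.
move=> sv c0 vw b; have [E HE] := sv (c * b); exists (c^-1 * (E + D)) => y y0.
rewrite -(ler_pM2l c0) mulrDr mulVKf ?gt_eqF//.
have := HE y y0; have := vw _ (expR_ge0 y); rewrite -!/(phi _ _); lra.
Qed.

Let nL : nneg_fun L. Proof. by apply: legendre_nneg; auto. Qed.
Let zL : zero01 L. Proof. by apply: legendre_zero01; auto. Qed.
Let sL : superlog L. Proof. by apply: legendre_superlog; auto. Qed.

Let nQ l j : 0 < l -> 0 < j -> nneg_fun (Q l j).
Proof. by move=> l0 j0; apply: legendre_nneg; apply: omega_wmatrix_nneg. Qed.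

Let sQ l j : 0 < l -> 0 < j -> superlog (Q l j).
Proof.
move=> l0 j0; have [D HD] := L_le_Q l0 j0.
by apply: superlog_compare sL _ HD; rewrite mulr_gt0// addr_gt0.
Qed.

Lemma wequiv_Q_L l j : 0 < l -> 0 < j -> wequiv (Q l j) L.
Proof.
move=> l0 j0; split.
  by apply: bigO_compare (nQ l0 j0) nL sL _ => t; exact: Q_le_L.
have [D HD] := L_le_Q l0 j0.
by apply: bigO_compare nL (nQ l0 j0) (sQ l0 j0) HD.
Qed.

Let nO l j : 0 < l -> 0 < j -> nneg_fun (O l j).
Proof. by move=> l0 j0 t t0; rewrite omega_mulE// nQ. Qed.

Let O_le_L l j t : 0 < l -> 0 < j -> 0 <= t -> O l j t <= (l^-1 + j^-1) * L t + 0.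
Proof. by move=> l0 j0 t0; rewrite omega_mulE// Q_le_L. Qed.

Let L_le_O l j : 0 < l -> 0 < j ->
  exists D, forall t, 0 <= t -> L t <= 2 * (l + j) * O l j t + D.
Proof.
move=> l0 j0; have [D HD] := L_le_Q l0 j0; exists D => t t0.
by rewrite omega_mulE// HD.
Qed.

Let sO l j : 0 < l -> 0 < j -> superlog (O l j).
Proof.
move=> l0 j0; have [D HD] := L_le_O l0 j0.
by apply: superlog_compare sL _ HD; rewrite mulr_gt0// addr_gt0.
Qed.

Let zO l j : 0 < l -> 0 < j -> zero01 (O l j).
Proof.
move=> l0 j0 t t01; have /andP[t0 _] := t01.
apply/eqP; rewrite eq_le nO// andbT.
by apply: le_trans (O_le_L l0 j0 t0) _; rewrite zL// mulr0 addr0.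
Qed.

Lemma wequiv_O_O l j : 0 < l -> 0 < j -> wequiv (O l l) (O j j).
Proof.
suff H a b : 0 < a -> 0 < b -> (O a a : R -> R^o) =O_ (pinfty_nbhs R) (O b b : R -> R^o).
  by move=> l0 j0; split; apply: H.
move=> a0 b0; have [D HD] := L_le_O b0 b0.
apply: (@bigO_compare R _ _ ((a^-1 + a^-1) * (2 * (b + b))) ((a^-1 + a^-1) * D)) => //.
- exact: nO.
- exact: nO.
- exact: sO.
move=> t t0; apply: le_trans (O_le_L a0 a0 t0) _; rewrite addr0 -mulrA -mulrDr.
by rewrite ler_wpM2l ?HD// addr_ge0// invr_ge0 ltW.
Qed.

(** The argument l (p + q) is the midpoint of 2 l p and 2 l q; the resulting factor 1 / 2 is the one
    contained in 1 / (2 l). *)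
Lemma wmatrix_mul_split l (p q : nat) : 0 < l ->
  S l (p + q)%N * T l (p + q)%N <=
  S (2 * l) p * T (2 * l) p * (S (2 * l) q * T (2 * l) q).
Proof.
move=> l0; have H w : W0 w -> wmatrix w l (p + q)%N <= wmatrix w (2 * l) p * wmatrix w (2 * l) q.
  move=> ww; rewrite -expRD ler_expR -mulrDr.
  rewrite -(ler_pM2l (mulr_gt0 (ltr0n R 2) l0)) mulrA mulrA divff ?mulf_neq0 ?gt_eqF// mul1r.
  rewrite mulfK ?gt_eqF// natrD mulrDr -!mulrA.
  exact: phi_star_midpoint (W0_zero01 ww) (W0_superlog ww).
rewrite mulrACA; apply: ler_pM; rewrite ?(ltW (wmatrix_gt0 _ _ _)) ?H//.
Qed.

(** The matrix of the weight with [omega1] absorbs h^p; the other one only has to increase with its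
    index. *)
Lemma wmatrix_mul_omega1 (h : R) : omega1 sigma \/ omega1 tau -> 1 <= h ->
  exists2 d : R, 1 <= d & forall l : R, 0 < l -> exists2 D : R, 1 <= D &
  forall p : nat, h ^+ p * S l p * T l p <= D * S (d * l) p * T (d * l) p.
Proof.
have D1 l : 0 < l -> 1 <= expR l^-1.
  by move=> l0; rewrite -expR0 ler_expR invr_ge0 ltW.
have mono w d l p : W0 w -> 1 <= d -> 0 < l -> wmatrix w l p <= wmatrix w (d * l) p.
  move=> ww d1 l0; apply: (wmatrix_le p (W0_zero01 ww) (W0_superlog ww) (W0_nneg ww) l0).
  by rewrite ler_peMl// ltW.
case=> w1 h1.
  have [d d1 Hd] := wmatrix_omega1 ws w1 h1; exists d => // l l0.
  exists (expR l^-1) => [|p]; first exact: D1.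
  apply: ler_pM; rewrite ?mulr_ge0 ?exprn_ge0 ?Hd ?mono// ?(ltW (wmatrix_gt0 _ _ _))//.
  by rewrite (le_trans _ h1).
have [d d1 Hd] := wmatrix_omega1 wt w1 h1; exists d => // l l0.
exists (expR l^-1) => [|p]; first exact: D1.
rewrite mulrAC [leRHS]mulrAC.
apply: ler_pM; rewrite ?mulr_ge0 ?exprn_ge0 ?Hd ?mono// ?(ltW (wmatrix_gt0 _ _ _))//.
by rewrite (le_trans _ h1).
Qed.

Lemma mprod_gt0 l p : 0 < mprod S T l p.
Proof. by rewrite mulr_gt0 ?wmatrix_gt0. Qed.

Lemma fspace_mat_legendre (F : fclass R) k : omega1 sigma \/ omega1 tau -> weighted_class F ->
  fspace F k (mat_weights (mprod S T)) = fspace F k (omega_weights L).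
Proof.
move=> w1 HF.
have LE l : 0 < l -> wmatrix L l = S l \* T l by move=> l0; apply: wmatrix_legendre; auto.
have dom (h : R) : 0 < h -> exists2 d, 0 < d & forall l, 0 < l ->
    dominated (fun p => h ^+ p * mprod S T l p) (wmatrix L (d * l)).
  (* Absorption is available for factors at least 1, and h <= g covers smaller ones. *)
  move=> h0; pose g := Num.max h 1.
  have [|d d1 Hd] := wmatrix_mul_omega1 (h := g) w1; first by rewrite le_max lexx orbT.
  have d0 : 0 < d by rewrite (lt_le_trans _ d1).
  exists d => // l l0; have [D D1 HD] := Hd l l0.
  exists D; first by rewrite (lt_le_trans _ D1).
  move=> p; rewrite LE ?mulr_gt0//.
  apply: (@le_trans _ _ (D * S (d * l) p * T (d * l) p)); last by rewrite /= mulrA.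
  apply: le_trans (HD p).
  rewrite -mulrA ler_wpM2r ?(ltW (mprod_gt0 _ _))//.
  by rewrite lerXn2r ?nnegrE ?le_max ?lexx// ltW.
apply: fspace_eq => //.
- by move=> a; apply: posw_mat_weights; exact: mprod_gt0.
- exact: posw_omega_weights.
- split=> _ [l [h [l0 h0 ->]]].
    have [d d0 Hd] := dom h h0.
    by exists (wmatrix L (d * l)); [exists (d * l) => //=; rewrite mulr_gt0|exact: Hd].
  (* For a weight below h^p S^(l) T^(l), the factor h^-p is absorbed when passing from the index l /
     d up to l. *)
  have ih0 : 0 < h^-1 by rewrite invr_gt0.
  have [d d0 Hd] := dom _ ih0.
  have ld0 : 0 < l / d by rewrite divr_gt0.
  exists (wmatrix L (l / d)); first by exists (l / d).
  have [D D0 HD] := Hd _ ld0; exists D => // p.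
  rewrite mulrCA -ler_pdivrMl ?exprn_gt0// -exprVn LE//.
  by have := HD p; rewrite (mulrC d) divfK ?gt_eqF// LE.
- split=> _ [l /= l0 <-]; exists (fun p => 1 ^+ p * mprod S T l p).
  + by exists l, 1.
  + by exists 1 => // p; rewrite LE// expr1n !mul1r.
  + by exists l, 1.
  + by exists 1 => // p; rewrite LE// expr1n !mul1r.
Qed.

Lemma fspace_omega_legendre (F : fclass R) k l j : weighted_class F -> 0 < l -> 0 < j ->
  fspace F k (omega_weights (O l j)) = fspace F k (omega_weights L).
Proof.
move=> HF l0 j0; have [D HD] := L_le_O l0 j0.
have c0 : 0 < l^-1 + j^-1 by rewrite addr_gt0 ?invr_gt0.
have c'0 : 0 < 2 * (l + j) by rewrite mulr_gt0// addr_gt0.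
have OL t : 0 <= t -> O l j t <= (l^-1 + j^-1) * L t + 0 by exact: O_le_L.
apply: fspace_eq => //; try exact: posw_omega_weights.
  exact: cofinal_omega_weights (zO l0 j0) zL (sO l0 j0) sL c0 c'0 OL HD.
exact: cofinal_omega_weights zL (zO l0 j0) sL (sO l0 j0) c'0 c0 HD OL.
Qed.

(** Doubling the index costs a geometric factor; after n doublings 2^n j exceeds l and monotonicity
    in the index concludes. Thus all rows of the matrix agree up to geometric factors, and a single
    one can replace the matrix. *)
Lemma wmatrix_omega6_geom w l j : W0 w -> omega6 w -> 0 < l -> 0 < j ->
  geom_dominated (wmatrix w l) (wmatrix w j).
Proof.
move=> ww /(wmatrix_omega6 ww)[H H1 HH] l0 j0.
have H0 : 0 < H by rewrite (lt_le_trans _ H1).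
have it n : geom_dominated (wmatrix w (2 ^+ n * j)) (wmatrix w j).
  elim: n => [|n [C [h [C1 h1 IH]]]].
    by exists 1, 1; split=> // p; rewrite expr0 expr1n !mul1r.
  have m0 : 0 < 2 ^+ n * j by rewrite mulr_gt0// exprn_gt0.
  have E1 : 1 <= expR (H / (2 * (2 ^+ n * j))).
    rewrite -[leLHS]expR0 ler_expR; apply: divr_ge0; first exact: ltW.
    by apply: mulr_ge0 => //; exact: ltW.
  exists (expR (H / (2 * (2 ^+ n * j))) * C), (H * h); split.
  - by rewrite (le_trans E1)// ler_peMr// expR_ge0.
  - by rewrite (le_trans H1)// ler_peMr// ltW.
  move=> p; rewrite exprS -mulrA; apply: le_trans (HH _ p m0) _.
  rewrite exprMn; have -> : expR (H / (2 * (2 ^+ n * j))) * C * (H ^+ p * h ^+ p) * wmatrix w j p =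
    expR (H / (2 * (2 ^+ n * j))) * H ^+ p * (C * h ^+ p * wmatrix w j p) by ring.
  by rewrite ler_pM2l// mulr_gt0 ?expR_gt0// exprn_gt0.
pose n := Num.bound (l / j).
have [C [h [C1 h1 HC]]] := it n; exists C, h; split=> // p.
apply: le_trans (HC p).
apply: (wmatrix_le p (W0_zero01 ww) (W0_superlog ww) (W0_nneg ww) l0).
rewrite -ler_pdivrMr// (le_trans (ltW (archi_boundP _)))//.
  by rewrite divr_ge0// ltW.
by rewrite -natrX ler_nat ltnW// ltn_expl.
Qed.

Lemma geom_dominated_mul a b a' b' : posw (R := R) a -> posw a' -> geom_dominated a b ->
  geom_dominated a' b' -> geom_dominated (a \* a') (b \* b').
Proof.
move=> a0 a'0 [C [h [C1 h1 H]]] [C' [h' [C'1 h'1 H']]].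
have C0 : 0 <= C by rewrite (le_trans _ C1).
have h0 : 0 <= h by rewrite (le_trans _ h1).
exists (C * C'), (h * h'); split.
- by rewrite (le_trans C1)// ler_peMr.
- by rewrite (le_trans h1)// ler_peMr.
move=> p /=; rewrite exprMn.
have -> : C * C' * (h ^+ p * h' ^+ p) * (b p * b' p) =
  C * h ^+ p * b p * (C' * h' ^+ p * b' p) by ring.
by apply: ler_pM => //; apply: ltW.
Qed.

Lemma geom_dominated_refl a : geom_dominated (R := R) a a.
Proof. by exists 1, 1; split=> // p; rewrite expr1n !mul1r. Qed.

Lemma mapprox_fspace M N : (forall l p, 0 < M l p) -> (forall l p, 0 < N l p) ->
    (forall l, 0 < l -> geom_dominated (R := R) (M l) (N l)) ->
    (forall l, 0 < l -> geom_dominated (N l) (M l)) ->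
  (forall k, mapprox k M N) /\ (forall F : fclass R, weighted_class F -> forall k : kind,
             fspace F k (mat_weights M) = fspace F k (mat_weights N)).
Proof.
move=> M0 N0 MN NM; split=> [k|F HF k]; first exact: mapprox_geom.
apply: fspace_eq => //; try by move=> a; exact: posw_mat_weights.
  exact: cofinal_mat_weights.
exact: cofinal_mat_weights.
Qed.

End Pairs.

Theorem theorem3p2 (R : realType) (sigma tau : R -> R) :
  W0 sigma -> W0 tau ->
  let S := wmatrix sigma in let T := wmatrix tau in
  [/\ (forall l l1 : R, 0 < l -> 0 < l1 ->
        (forall t, 0 <= t -> omega_of (S l \* T l1) t =
           legendre (omega_of (S l)) (omega_of (T l1)) t) /\
        wequiv (legendre (omega_of (S l)) (omega_of (T l1)))
          (legendre sigma tau)) /\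
      (forall l j : R, 0 < l -> 0 < j ->
        wequiv (omega_of (S l \* T l)) (omega_of (S j \* T j))),
      (forall l : R, 0 < l -> forall p q : nat,
        S l (p + q)%N * T l (p + q)%N
          <= S (2 * l) p * T (2 * l) p * (S (2 * l) q * T (2 * l) q)),
      (omega1 sigma \/ omega1 tau ->
        forall h : R, 1 <= h -> exists2 d : R, 1 <= d &
        forall l : R, 0 < l -> exists2 D : R, 1 <= D &
        forall p : nat,
          h ^+ p * S l p * T l p <= D * S (d * l) p * T (d * l) p),
      (omega1 sigma \/ omega1 tau ->
        forall F : fclass R, weighted_class F -> forall (k : kind) (l j : R),
        0 < l -> 0 < j ->
          fspace F k (mat_weights (mprod S T)) =
            fspace F k (omega_weights (omega_of (S l \* T j))) /\
          fspace F k (omega_weights (omega_of (S l \* T j))) =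
            fspace F k (omega_weights (legendre sigma tau))) &
      (omega1 sigma \/ omega1 tau ->
        (omega6 tau -> forall j : R, 0 < j ->
          (forall k, mapprox k (mprod S T) (mprod S (fun=> T j))) /\
          (forall F : fclass R, weighted_class F -> forall k : kind,
             fspace F k (mat_weights (mprod S T)) =
               fspace F k (mat_weights (mprod S (fun=> T j))))) /\
        (omega6 sigma -> forall l : R, 0 < l ->
          (forall k, mapprox k (mprod S T) (mprod (fun=> S l) T)) /\
          (forall F : fclass R, weighted_class F -> forall k : kind,
             fspace F k (mat_weights (mprod S T)) =
               fspace F k (mat_weights (mprod (fun=> S l) T)))))].
Proof.
move=> ws wt S T; split.
- split=> [l l1 l0 l10|l j l0 j0]; last exact: wequiv_O_O.
  split; last exact: wequiv_Q_L.
  by move=> t; exact: omega_mulE.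
- by move=> l l0 p q; exact: wmatrix_mul_split.
- by move=> w1 h h1; exact: wmatrix_mul_omega1.
- move=> w1 F HF k l j l0 j0; rewrite fspace_omega_legendre//.
  by rewrite fspace_mat_legendre.
have S0 l p : 0 < S l p by exact: wmatrix_gt0.
have T0 l p : 0 < T l p by exact: wmatrix_gt0.
move=> _; split=> [w6 j j0|w6 l l0]; apply: mapprox_fspace.
- by move=> l p; rewrite mulr_gt0.
- by move=> l p; rewrite mulr_gt0.
- move=> l l0; apply: geom_dominated_mul; [exact: S0|exact: T0|exact: geom_dominated_refl|].
  exact: wmatrix_omega6_geom.
- move=> l l0; apply: geom_dominated_mul; [exact: S0|exact: T0|exact: geom_dominated_refl|].
  exact: wmatrix_omega6_geom.
- by move=> j p; rewrite mulr_gt0.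
- by move=> j p; rewrite mulr_gt0.
- move=> j j0; apply: geom_dominated_mul; [exact: S0|exact: T0| |exact: geom_dominated_refl].
  exact: wmatrix_omega6_geom.
- move=> j j0; apply: geom_dominated_mul; [exact: S0|exact: T0| |exact: geom_dominated_refl].
  exact: wmatrix_omega6_geom.
Qed.
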